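(* Let $\mathbb{H}$ be a separable real Hilbert space with orthonormal basis $(e_i)_{i\ge 1}$, let $X$ be a random element in $\mathbb{H}$, and let $\alpha>0$. For $t>0$ let $\Theta_t$ be a random element of the unit sphere $\mathbb{S}=\{x\in\mathbb{H}:\|x\|=1\}$ with distribution $P_{\Theta,t}=\mathbb{P}(X/\|X\|\in\cdot\,\mid\,\|X\|>t)$. Let $P_{\Theta,\infty}$ be a probability measure on $(\mathbb{S},\mathcal{B}(\mathbb{S}))$ and let $\Theta_\infty$ be a random element distributed according to $P_{\Theta,\infty}$. The following statements are equivalent. 1. $X$ is regularly varying in $\mathbb{H}$ with index $\alpha$ and limit angular measure $P_{\Theta,\infty}$, so that $P_{\Theta,t}\to P_{\Theta,\infty}$ weakly as $t\to\infty$. 2. $\|X\|$ is regularly varying in $\mathbb{R}$ with index $\alpha$, and for every $h\in\mathbb{H}$, $\langle\Theta_t,h\rangle$ converges in distribution to $\langle\Theta_\infty,h\rangle$ as $t\to\infty$. 3. $\|X\|$ is regularly varying in $\mathbb{R}$ with index $\alpha$, and for every integer $N\ge 1$, $\pi_N(\Theta_t)$ converges in distribution to $\pi_N(\Theta_\infty)$ as $t\to\infty$.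
   Context: A random element of a space is a Borel-measurable map from a probability space into it. $\pi_N:\mathbb{H}\to\mathbb{R}^N$ is $\pi_N(x)=(\langle x,e_1\rangle,\dots,\langle x,e_N\rangle)$. Regular variation. Let $E$ be a separable real Banach space (here $E=\mathbb{H}$ or $E=\mathbb{R}$) and $E_0=E\setminus\{0\}$. Let $\mathcal{C}_0$ be the set of bounded continuous functions $f:E_0\to\mathbb{R}$ vanishing in some neighborhood of $0$, and $M_0(E)$ the class of Borel measures on $E_0$ that are finite on every Borel subset of $E_0$ bounded away from $0$. A sequence $\mu_n$ converges to $\mu$ in $M_0(E)$ if $\int f\,d\mu_n\to\int f\,d\mu$ for all $f\in\mathcal{C}_0$. A measurable function $b$ is regularly varying with index $\rho$ if $b(tx)/b(t)\to x^\rho$ as $t\to\infty$ for every $x>0$. A random element $X$ of $E$ is regularly varying with index $\alpha>0$ (written $X\in RV_{-\alpha}(E)$) if there exist a nonzero $\mu\in M_0(E)$ and a regularly varying function $b$ such that $b(n)\,\mathbb{P}(X\in n\,\cdot)\to\mu(\cdot)$ in $M_0(E)$ as $n\to\infty$, where the limit satisfies $\mu(tA)=t^{-\alpha}\mu(A)$ for all $t>0$ and Borel $A\subset E_0$. ''$X$ is regularly varying with index $\alpha$ and limit angular measure $P_{\Theta,\infty}$'' means: $X\in RV_{-\alpha}(\mathbb{H})$ and $P_{\Theta,t}\to P_{\Theta,\infty}$ weakly on $\mathbb{S}$ as $t\to\infty$. (Regular variation of $\|X\|$ ensures $\mathbb{P}(\|X\|>t)>0$ for all $t>0$, so that $P_{\Theta,t}$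 is well defined.) *)

(* Defs.v *)
From HB Require Import structures.
From mathcomp Require Import all_boot all_order all_algebra.
From mathcomp Require Import all_classical all_reals all_analysis.

Set Implicit Arguments.
Unset Strict Implicit.
Unset Printing Implicit Defensive.

Import Order.TTheory GRing.Theory Num.Theory.
Import numFieldNormedType.Exports.

Local Open Scope classical_set_scope.
Local Open Scope ring_scope.

Definition borel (T : ptopologicalType) := g_sigma_algebraType (@open T).

Definition random_element d (Omega : measurableType d) (T : ptopologicalType)
    (X : Omega -> T) : Prop :=
  measurable_fun [set: Omega] (X : Omega -> borel T).

Definition separable (T : topologicalType) : Prop :=
  exists2 D : set T, countable D & dense D.

Section Hilbert.
Context (R : realType) (H : normedModType R).

(* [H] is a Hilbert space when it is complete and its norm is induced by
   [dot]. *)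
Definition norm_induced_by (dot : {dot H for idfun}) : Prop :=
  forall x : H, `|x| = Num.sqrt (dot x x).

(* The basis vectors are numbered from 0. *)
Definition orthonormal_basis (dot : {dot H for idfun}) (e : nat -> H) : Prop :=
  (forall i j : nat, dot (e i) (e j) = (i == j)%:R) /\
  (forall x : H, (\sum_(i < n) dot x (e i) *: e i) @[n --> \oo] --> x).

Definition coordinates (dot : {dot H for idfun}) (e : nat -> H) (N : nat)
  (x : H) : 'rV[R]_N := \row_(i < N) dot x (e i).

Definition unit_sphere : set H := [set x | `|x| = 1].

End Hilbert.
Arguments unit_sphere {R} H.

Section RegularVariation.
Context (R : realType).

Definition regularly_varying_fun (b : R -> R) (rho : R) : Prop :=
  measurable_fun (`]0, +oo[ : set R) b /\
  forall x : R, 0 < x -> b (t * x) / b t @[t --> +oo] --> x `^ rho.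

Section Space.
Context (E : normedModType R).

Definition punctured : set E := ~` [set 0].

Definition bounded_away (A : set E) : Prop :=
  exists2 r : R, 0 < r & forall x, A x -> r <= `|x|.

(* Functions on the punctured space are functions on [E] whose value at 0 is
   ignored. *)
Definition C0 (f : E -> R) : Prop :=
  [/\ {within punctured, continuous f},
      [bounded f x | x in punctured] &
      \forall x \near (0 : E)^', f x = 0].

(* A Borel measure on the punctured space is represented by a Borel measure on
   [E], of which only the trace on [punctured] is ever used. *)
Definition M0 (mu : {measure set (borel E) -> \bar R}) : Prop :=
  forall A : set (borel E), measurable A -> A `<=` punctured ->
    bounded_away A -> (mu A < +oo)%E.

Definition M0_cvg (mu_ : nat -> set (borel E) -> \bar R)
    (mu : set (borel E) -> \bar R) : Prop :=
  forall f : E -> R, C0 f ->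
    (\int[mu_ n]_(x in (punctured : set (borel E))) (f x)%:E)%E @[n --> \oo]
    --> (\int[mu]_(x in (punctured : set (borel E))) (f x)%:E)%E.

Definition dilate (t : R) (A : set E) : set E := [set t *: x | x in A].

(* [b] is asked to be nonnegative at the positive integers because
   [A |-> b n * P (X \in n A)] has to be a measure. *)
Definition regularly_varying d (Omega : measurableType d)
    (P : probability Omega R) (alpha : R) (X : Omega -> E) : Prop :=
  exists (mu : {measure set (borel E) -> \bar R}) (b : R -> R) (rho : R),
    [/\ M0 mu /\ mu punctured <> 0%E,
        regularly_varying_fun b rho,
        forall n : nat, (0 < n)%N -> 0 <= b n%:R,
        M0_cvg (fun n A => (b n%:R)%:E * P (X @^-1` dilate n%:R A))%E mu &
        forall (t : R) (A : set (borel E)), 0 < t -> measurable A ->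
          A `<=` punctured -> mu (dilate t A) = ((t `^ (- alpha))%:E * mu A)%E].

Definition exceeds d (Omega : measurableType d) (X : Omega -> E) (t : R) :
  set Omega := [set w | t < `|X w|].

(* The law of X / |X| conditionally on |X| > t; it is the zero set function
   when the conditioning event is negligible. *)
Definition angular_law d (Omega : measurableType d)
    (P : probability Omega R) (X : Omega -> E) (t : R)
    (A : set (borel E)) : \bar R :=
  (P ([set w | A (`|X w|^-1 *: X w)%R] `&` exceeds X t)
   * (fine (P (exceeds X t)))^-1%:E)%E.

End Space.
End RegularVariation.

Section Convergence.
Context (R : realType).

(* Weak convergence, as t tends to +oo, of measures on the subspace [S] of [T].
   They are represented by Borel measures on [T] carried by [S]. *)
Definition weak_cvg_on (T : ptopologicalType) (S : set T)
    (mu_ : R -> set (borel T) -> \bar R) (mu : set (borel T) -> \bar R) :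
    Prop :=
  forall f : T -> R, {within S, continuous f} -> [bounded f x | x in S] ->
    (\int[mu_ t]_(x in (S : set (borel T))) (f x)%:E)%E @[t --> +oo]
    --> (\int[mu]_(x in (S : set (borel T))) (f x)%:E)%E.

(* The random elements [Y t] may live on different probability spaces. *)
Definition cvg_in_distribution (T : topologicalType)
    (d_ : R -> measure_display) (Omega_ : forall t, measurableType (d_ t))
    (P_ : forall t, probability (Omega_ t) R) (Y_ : forall t, Omega_ t -> T)
    d (Omega : measurableType d) (P : probability Omega R) (Y : Omega -> T) :
    Prop :=
  forall g : T -> R, continuous g -> [bounded g y | y in [set: T]] ->
    'E_(P_ t)[g \o Y_ t]%E @[t --> +oo] --> 'E_P[g \o Y]%E.

Definition has_law d (Omega : measurableType d) (P : probability Omega R)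
    (T : ptopologicalType) (Y : Omega -> T) (nu : set (borel T) -> \bar R) :
    Prop :=
  forall A : set (borel T), measurable A -> P (Y @^-1` A) = nu A.

End Convergence.

(* Main.v *)
From HB Require Import structures.
Require Import Defs.
From mathcomp Require Import all_boot all_order all_algebra.
From mathcomp Require Import all_classical all_reals all_analysis.
From mathcomp Require Import measurable_realfun ring lra.
Import Order.TTheory GRing.Theory Num.Theory.
Import numFieldNormedType.Exports.
Local Open Scope classical_set_scope.
Local Open Scope ring_scope.

Set Implicit Arguments.
Unset Strict Implicit.
Unset Printing Implicit Defensive.

(* (1) => (2): push the limit measure forward by the norm.

   (2) => (3): the coordinates of a point of the sphere lie in a compact box, on
   which the span of the functions exp <v, .> is an algebra; by a
   Stone-Weierstrass argument it approximates every Lipschitz function, so the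
   one-dimensional projections determine weak convergence.

   (3) => (1): on the sphere |x - p_N x|^2 = 1 - |p_N x|^2 is a function of the
   coordinates, so E |Theta_t - p_N Theta_t|^2 converges to its value at the
   limit, which is small for large N; hence Lipschitz test functions converge.
   The limit measure of X is the image under (theta, r) |-> r theta of Pinf
   times the radial limit measure. Test functions are approximated by radial
   staircases, for which convergence factors into a tail probability of |X| and
   an angular integral.

   In the last two steps arbitrary bounded continuous test functions are reached from
   Lipschitz ones by squeezing. *)

(** * Squeezing continuous functions between Lipschitz ones *)

(** The unit sphere is not compact in infinite dimension and a test function on it is merely
    continuous, so replacing x by its projection p_N x has no uniform effect; a Lipschitz bound
    makes the error proportional to |x - p_N x|. In R^N real exponentials replace characteristic
    functions: on a compact box they are bounded, their products are exponentials again, and each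
    depends on a point through a single inner product, which is all that (2) speaks of. The limit
    measure is written down explicitly rather than extracted by compactness. Sharp shells |x| > r
    are usable despite their discontinuous indicators because of homogeneity: the tail mass is a
    multiple of r^(-alpha), hence continuous in r. Regular variation of X and of |X| share the same
    normalization b; restricting the law of X/n to |x| > r amounts to conditioning on |X| > n r, so
    the angular convergence is used along t = n r. Each of the three statements also forces P(|X| >
    t) > 0 for all t > 0, without which the conditional laws would be zero and nothing would be
    known of Theta_t. *)

(** The bounds may change with [e], and their limits only have to come within [e] of [l]: this is
    the form in which one-sided approximations of a test function arrive. *)
Lemma cvg_sandwich (R : realType) (I : Type) (F : set_system I) (FF : Filter F)
    (u : I -> R) (l : R) :
  (forall e, 0 < e -> exists v a,
    [/\ v @ F --> a, l - e <= a & \forall t \near F, v t <= u t]) ->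
  (forall e, 0 < e -> exists w b,
    [/\ w @ F --> b, b <= l + e & \forall t \near F, u t <= w t]) ->
  u @ F --> l.
Proof.
move=> low up; apply/cvgrPdist_le => e e0.
have e2 : 0 < e / 2 by lra.
have [v [a [va la vu]]] := low _ e2.
have [w [b [wb lb uw]]] := up _ e2.
move/cvgrPdist_le: va => /(_ _ e2) va.
move/cvgrPdist_le: wb => /(_ _ e2) wb.
near=> t.
have h1 : v t <= u t by near: t.
have h2 : u t <= w t by near: t.
have /ler_normlP[h3 h4] : `|a - v t| <= e / 2 by near: t.
have /ler_normlP[h5 h6] : `|b - w t| <= e / 2 by near: t.
by apply/ler_normlP; split; lra.
Unshelve. all: by end_near. Qed.

Lemma within_continuous_dist (R : realType) (E : normedModType R) (S : set E)
    (f : E -> R) x e : {within S, continuous f} -> S x -> 0 < e ->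
  exists2 d, 0 < d & forall y, S y -> `|x - y| < d -> `|f x - f y| <= e.
Proof.
move=> /subspace_continuousP cf Sx e0.
have /cvgrPdist_le/(_ _ e0) := cf _ Sx.
rewrite near_withinE => /nbhs_ballP[d /= d0 xd].
by exists d => // y Sy xy; apply: xd => //; rewrite -ball_normE.
Qed.

(* Baire's regularization: the infimal convolutions of [f] with [k * |x|]. *)
Lemma lipschitz_minorants (R : realType) (E : normedModType R) (S : set E)
    (f : E -> R) (M : R) :
  S !=set0 -> {within S, continuous f} -> (forall x, S x -> 0 <= f x <= M) ->
  exists g : nat -> E -> R,
    [/\ forall k x, 0 <= g k x <= M,
        forall k x y, `|g k x - g k y| <= k%:R * `|x - y|,
        forall k x, S x -> g k x <= f x &
        forall x, S x -> g ^~ x @ \oo --> f x].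
Proof.
move=> [s0 Ss0] cf f0M.
have M0 : 0 <= M by have /andP[] := f0M _ Ss0; exact: le_trans.
(* Truncation at [M] keeps [g k] bounded also at points far from [S], and does not spoil the
   Lipschitz constant [k]. *)
pose V k x := [set Num.min M (f y + k%:R * `|x - y|) | y in S].
have Vn0 (k : nat) x : V k x !=set0 by exists (Num.min M (f s0 + k%:R * `|x - s0|)), s0.
have V0 (k : nat) x : lbound (V k x) 0.
  move=> _ [y Sy <-]; rewrite le_min M0/= addr_ge0 ?mulr_ge0//.
  by have /andP[] := f0M _ Sy.
have Vlb (k : nat) x : has_lbound (V k x) by exists 0.
pose g (k : nat) x := inf (V k x).
have gle (k : nat) x y : S y -> g k x <= Num.min M (f y + k%:R * `|x - y|).
  by move=> Sy; apply: ge_inf => //; exists y.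
have g1 (k : nat) x y : g k x <= g k y + k%:R * `|x - y|.
  rewrite -lerBlDr; apply: lb_le_inf => // _ [z Sz <-].
  have := gle k x z Sz; have h : k%:R * `|x - z| <= k%:R * `|x - y| + k%:R * `|y - z|.
    by rewrite -mulrDr ler_wpM2l// ler_distD.
  have k0 : 0 <= k%:R * `|x - y| :> R by rewrite mulr_ge0.
  by rewrite !le_min => /andP[? ?]; apply/andP; split; lra.
exists g; split.
- move=> k x; apply/andP; split; first exact: lb_le_inf.
  by have := gle k x _ Ss0; rewrite le_min => /andP[].
- move=> k x y; apply/ler_normlP; split; last by have := g1 k x y; lra.
  by have := g1 k y x; rewrite distrC; lra.
- move=> k x Sx; have := gle k x _ Sx.
  by rewrite subrr normr0 mulr0 addr0 le_min => /andP[].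
- move=> x Sx; apply/cvgrPdist_le => e e0.
  have [d d0 xd] := within_continuous_dist cf Sx e0.
  near=> k; have /andP[fx0 fxM] := f0M _ Sx.
  have gf : g k x <= f x.
    by have := gle k x _ Sx; rewrite subrr normr0 mulr0 addr0 le_min => /andP[].
  rewrite ger0_norm ?subr_ge0// lerBlDr addrC -lerBlDr.
  apply: lb_le_inf => // _ [y Sy <-]; have /andP[fy0 fyM] := f0M _ Sy.
  rewrite le_min; apply/andP; split; first lra.
  (* Near [x] continuity bounds [f y] from below; at distance [d] or more the penalty alone reaches
     [M] once [k >= M / d]. *)
  have [xy|xy] := ltP `|x - y| d.
    have kxy : 0 <= k%:R * `|x - y| by rewrite mulr_ge0.
    by have /ler_normlP[? ?] := xd _ Sy xy; lra.
  have kd : M / d <= k%:R by near: k; exact: nbhs_infty_ger.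
  have : M <= k%:R * `|x - y|.
    by move: kd; rewrite ler_pdivrMr// => /le_trans; apply; rewrite ler_wpM2l.
  by lra.
Unshelve. all: by end_near. Qed.

Lemma lipschitz_continuous (R : realType) (E : normedModType R) (f : E -> R)
    (k : R) : (forall x y, `|f x - f y| <= k * `|x - y|) -> continuous f.
Proof.
move=> fk x; apply/cvgrPdist_le => e e0.
have k1 : 0 < `|k| + 1 by rewrite ltr_wpDl.
near=> y.
apply: (le_trans (fk _ _)); apply: (@le_trans _ _ ((`|k| + 1) * `|x - y|)).
  by rewrite ler_wpM2r// (le_trans (ler_norm k))// lerDl.
rewrite mulrC -ler_pdivlMr//; near: y.
by apply: cvgr_dist_le => //; apply: divr_gt0.
Unshelve. all: by end_near. Qed.

(** * Borel measurability and dominated convergence *)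

Lemma borel_open_measurable (T : ptopologicalType) (A : set T) :
  open A -> measurable (A : set (borel T)).
Proof. by move=> oA; apply: sub_sigma_algebra. Qed.

Lemma borel_closed_measurable (T : ptopologicalType) (A : set T) :
  closed A -> measurable (A : set (borel T)).
Proof.
move=> cA; rewrite -(setCK A); apply: measurableC.
by apply: borel_open_measurable; exact: closed_openC.
Qed.

Lemma borel_within_continuous_measurable (R : realType) (T : ptopologicalType)
    (D : set T) (f : T -> R) : measurable (D : set (borel T)) ->
  {within D, continuous f} -> measurable_fun (D : set (borel T)) (f : borel T -> R).
Proof.
move=> mD /continuousP cf; apply: (measurability _ (RGenOpens.measurableE R)).
move=> _ [_ [a [b ->] <-]].
have oab : open (`]a, b[%classic : set R) by exact: interval_open.
have /open_subspaceP[V oV VD] := cf _ oab.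
rewrite setIC -VD; apply: measurableI => //.
exact: borel_open_measurable.
Qed.

Lemma borel_continuous_measurable (R : realType) (T : ptopologicalType)
    (f : T -> R) : continuous f -> measurable_fun setT (f : borel T -> R).
Proof.
move=> cf; apply: borel_within_continuous_measurable; first exact: measurableT.
exact: continuous_subspaceT.
Qed.

Lemma borel_continuous_measurable_map (T U : ptopologicalType) (f : T -> U) :
  continuous f -> measurable_fun setT (f : borel T -> borel U).
Proof.
move=> /continuousP cf; apply:
  (@measurability _ _ (borel T) (borel U) _ _ (@open U) erefl).
move=> _ [A oA <-]; rewrite setTI; apply: borel_open_measurable; exact: cf.
Qed.

Lemma Rintegral_dominated_cvg d (T : measurableType d) (R : realType)
    (mu : {measure set T -> \bar R}) (D : set T) (f_ : nat -> T -> R)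
    (f h : T -> R) : measurable D ->
  (forall n, measurable_fun D (f_ n)) -> measurable_fun D f ->
  (forall x, D x -> f_ ^~ x @ \oo --> f x) ->
  mu.-integrable D (EFin \o h) ->
  (forall n x, D x -> `|f_ n x| <= h x) ->
  \int[mu]_(x in D) f_ n x @[n --> \oo] --> \int[mu]_(x in D) f x.
Proof.
move=> mD mf_ mf cf ih fh.
have [] := @dominated_convergence _ _ _ mu D mD (fun n x => (f_ n x)%:E)
  (EFin \o f) (EFin \o h).
- by move=> n; exact/measurable_EFinP.
- exact/measurable_EFinP.
- by apply: aeW => x Dx; apply: cvg_EFin; [near=> n|exact: cf].
- exact: ih.
- by apply: aeW => x n Dx; rewrite /= lee_fin fh.
move=> intf _ cvgf; apply: fine_cvg.
by rewrite fineK//; exact: integrable_fin_num.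
Unshelve. all: by end_near. Qed.

Lemma integrable_le d (T : measurableType d) (R : realType)
    (mu : {measure set T -> \bar R}) (D : set T) (f h : T -> R) :
  measurable D -> measurable_fun D f ->
  mu.-integrable D (EFin \o h) -> (forall x, D x -> `|f x| <= h x) ->
  mu.-integrable D (EFin \o f).
Proof.
move=> mD mf ih fh; apply: (le_integrable mD _ _ ih).
  exact/measurable_EFinP.
by move=> x Dx; rewrite /= lee_fin (le_trans (fh _ Dx))// ler_norm.
Qed.

(** The envelope [chi] serves finite and infinite measures alike: it will be a constant on the box
    and on the sphere, and a cutoff vanishing near 0 on the punctured space. Finiteness enters
    through integrability of [chi] alone. Lower bounds come from Lipschitz minorants, upper bounds
    from the same argument for [- f]. *)
Lemma cvg_Rintegral_lipschitz (R : realType) (E : normedModType R)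
    (S : set (borel E)) (I : Type) (F : set_system I)
    (m_ : I -> {measure set (borel E) -> \bar R})
    (m : {measure set (borel E) -> \bar R}) (chi f : E -> R) (M k : R) :
  Filter F -> measurable S -> S !=set0 ->
  (forall x y, `|chi x - chi y| <= k * `|x - y|) ->
  (forall x, 0 <= chi x <= M) ->
  (\forall t \near F, (m_ t).-integrable S (EFin \o chi)) ->
  m.-integrable S (EFin \o chi) ->
  (forall phi c, (forall x y : E, `|phi x - phi y| <= c * `|x - y|) ->
    (forall x, 0 <= phi x <= M *+ 2) -> (forall x, S x -> phi x <= chi x *+ 2) ->
    \int[m_ t]_(x in S) phi x @[t --> F] --> \int[m]_(x in S) phi x) ->
  {within S, continuous f} -> (forall x, S x -> `|f x| <= chi x) ->
  \int[m_ t]_(x in S) f x @[t --> F] --> \int[m]_(x in S) f x.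
Proof.
move=> FF mS S0 chik chi0M ichi_ ichi Hphi.
have chi0 x : 0 <= chi x by have /andP[] := chi0M x.
have chiM x : chi x <= M by have /andP[] := chi0M x.
have cchi : continuous chi := lipschitz_continuous chik.
have low (h : E -> R) : {within S, continuous h} ->
    (forall x, S x -> `|h x| <= chi x) -> forall e, 0 < e ->
    exists v a, [/\ v @ F --> a, \int[m]_(x in S) h x - e <= a &
      \forall t \near F, v t <= \int[m_ t]_(x in S) h x].
  (* The shift makes the function nonnegative and at most [2 chi], as the minorants require; [chi]
     is itself an admissible test function, so its integral can be subtracted afterwards. *)
  move=> ch hchi e e0; pose h1 x := h x + chi x.
  have hb x : S x -> - chi x <= h x /\ h x <= chi x.
    by move=> /hchi/ler_normlP[? ?]; split => //; lra.
  have h1c : {within S, continuous h1}.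
    move=> x; apply: (@cvgD _ R^o); first exact: ch.
    by apply: continuous_subspaceT.
  have [|g [g0M gk gh1 gcvg]] := @lipschitz_minorants R E S h1 (M *+ 2) S0 h1c.
    move=> x Sx; have [? ?] := hb _ Sx; have := chiM x.
    by move=> ?; rewrite /h1; apply/andP; split; lra.
  have mchi : measurable_fun S (chi : borel E -> R).
    by apply: borel_within_continuous_measurable => //; exact: continuous_subspaceT.
  have mh : measurable_fun S (h : borel E -> R).
    exact: borel_within_continuous_measurable.
  have mg n : measurable_fun S (g n : borel E -> R).
    apply: borel_within_continuous_measurable => //; apply: continuous_subspaceT.
    exact: lipschitz_continuous (gk n).
  have gchi n x : S x -> g n x <= chi x *+ 2.
    by move=> Sx; have := gh1 n _ Sx; rewrite /h1; have [? ?] := hb _ Sx; lra.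
  have ichi2 (mu : {measure set (borel E) -> \bar R}) :
      mu.-integrable S (EFin \o chi) ->
      mu.-integrable S (EFin \o (fun x => chi x *+ 2)).
    move=> ic; rewrite (_ : _ \o _ = (fun x => 2%:E * (chi x)%:E)%E).
      exact: integrableZl.
    by apply/funext => x /=; rewrite -EFinM mulr_natl.
  have ig (mu : {measure set (borel E) -> \bar R}) n :
      mu.-integrable S (EFin \o chi) -> mu.-integrable S (EFin \o g n).
    move=> /ichi2 ic; apply: (integrable_le mS (mg n) ic) => x Sx.
    by rewrite ger0_norm ?gchi//; have /andP[] := g0M n x.
  have ih (mu : {measure set (borel E) -> \bar R}) :
      mu.-integrable S (EFin \o chi) -> mu.-integrable S (EFin \o h).
    by move=> ic; apply: (integrable_le mS mh ic).
  have gint : \int[m]_(x in S) g n x @[n --> \oo] --> \int[m]_(x in S) h1 x.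
    apply: (Rintegral_dominated_cvg mS mg _ gcvg (ichi2 _ ichi)).
      exact: measurable_funD.
    move=> n x Sx; rewrite ger0_norm ?gchi//; by have /andP[] := g0M n x.
  have [n] : exists n, \int[m]_(x in S) h1 x - e <= \int[m]_(x in S) g n x.
    move/cvgrPdist_le : gint => /(_ _ e0)[n _ /(_ _ (leqnn n))/= /ler_normlP[_ ?]].
    by exists n; lra.
  rewrite RintegralD//; [|exact: ih] => ng.
  exists (fun t => \int[m_ t]_(x in S) g n x - \int[m_ t]_(x in S) chi x).
  exists (\int[m]_(x in S) g n x - \int[m]_(x in S) chi x); split.
  - apply: (@cvgB _ R^o); first exact: (Hphi _ _ (gk n) (g0M n) (gchi n)).
    apply: (Hphi _ _ chik) => x.
      by have := chi0 x; have := chiM x; move=> ? ?; apply/andP; split; lra.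
    by have := chi0 x; lra.
  - lra.
  - near=> t; have ict : (m_ t).-integrable S (EFin \o chi) by near: t.
    rewrite lerBlDr -RintegralD//; [|exact: ih].
    apply: le_Rintegral => //; first exact: ig.
      exact: integrableD (ih _ ict) ict.
    by move=> x Sx; exact: gh1.
move=> cf fchi; apply: cvg_sandwich => [e e0|e e0]; first exact: low.
have [|x Sx|v [a [va la vu]]] := low (fun x => - f x) _ _ _ e0.
- by move=> x; apply: (@cvgN _ R^o); exact: cf.
- by rewrite normrN fchi.
have mf : measurable_fun S (f : borel E -> R).
  exact: borel_within_continuous_measurable.
have RN (mu : {measure set (borel E) -> \bar R}) :
    mu.-integrable S (EFin \o chi) ->
    \int[mu]_(x in S) (- f x) = - \int[mu]_(x in S) f x.
  move=> ic; under eq_Rintegral do rewrite -mulN1r.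
  by rewrite RintegralZl ?mulN1r//; exact: (integrable_le mS mf ic).
exists (fun t => - v t), (- a); split; first exact: (@cvgN _ R^o).
  by move: la; rewrite RN//; lra.
near=> t; have ict : (m_ t).-integrable S (EFin \o chi) by near: t.
have : v t <= \int[m_ t]_(x in S) (- f x) by near: t.
by rewrite RN//; lra.
Unshelve. all: by end_near. Qed.

(** * Exponential approximation on a box *)

Section RealContinuous.
Context (R : realType) (T : topologicalType).
Implicit Types f g : T -> R.

Lemma continuous_addr f g :
  continuous f -> continuous g -> continuous (fun x => f x + g x).
Proof. by move=> cf cg x; apply: (@cvgD _ R^o); [exact: cf|exact: cg]. Qed.

Lemma continuous_subr f g :
  continuous f -> continuous g -> continuous (fun x => f x - g x).
Proof. by move=> cf cg x; apply: (@cvgB _ R^o); [exact: cf|exact: cg]. Qed.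

Lemma continuous_mulr f g :
  continuous f -> continuous g -> continuous (fun x => f x * g x).
Proof. by move=> cf cg x; apply: cvgM; [exact: cf|exact: cg]. Qed.

Lemma continuous_sumr (J : Type) (r : seq J) (G : J -> T -> R) :
  (forall j, continuous (G j)) -> continuous (fun x => \sum_(j <- r) G j x).
Proof.
move=> cG; elim: r => [|j r IH].
  by under eq_fun do rewrite big_nil; exact: cst_continuous.
by under eq_fun do rewrite big_cons; exact: continuous_addr.
Qed.

Lemma continuous_expR_comp f : continuous f -> continuous (fun x => expR (f x)).
Proof.
by move=> cf x; apply: continuous_comp; [exact: cf|exact: continuous_expR].
Qed.

Lemma continuous_normr_comp f : continuous f -> continuous (fun x => `|f x|).
Proof.
move=> cf x; apply: (@continuous_comp T R R f (fun z => `|z|)); first exact: cf.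
exact: (@norm_continuous _ R^o).
Qed.

End RealContinuous.

Section CramerWold.
Context (R : realType) (N : nat).
Local Notation V := 'rV[R]_N.

Definition unit_box : set V := [set x | forall i, `|x 0 i| <= 1].

Definition pairing (v x : V) : R := \sum_i v 0 i * x 0 i.

(** An algebra thanks to the addition law of [expR], so that sums and scalings are the only
    operations to put among the constructors. *)
Inductive expspan : (V -> R) -> Prop :=
| expspan_exp v : expspan (fun x => expR (pairing v x))
| expspan_add f g : expspan f -> expspan g -> expspan (fun x => f x + g x)
| expspan_scale c f : expspan f -> expspan (fun x => c * f x).

Lemma expspan_mul f g : expspan f -> expspan g -> expspan (fun x => f x * g x).
Proof.
move=> sf sg; elim: sf => [v|f1 f2 _ s1 _ s2|c f1 _ s1].
- elim: sg => [w|g1 g2 _ s1 _ s2|c g1 _ s1].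
  + rewrite (_ : (fun _ => _) = (fun x => expR (pairing (v + w) x))).
      exact: expspan_exp.
    apply/funext => x; rewrite -expRD; congr expR.
    by rewrite /pairing -big_split; apply: eq_bigr => i _; rewrite mxE mulrDl.
  + under eq_fun do rewrite mulrDr; exact: expspan_add.
  + under eq_fun do rewrite mulrCA; exact: expspan_scale.
- under eq_fun do rewrite mulrDl; exact: expspan_add.
- under eq_fun do rewrite -mulrA; exact: expspan_scale.
Qed.

Lemma expspan_cst c : expspan (fun=> c).
Proof.
rewrite (_ : (fun _ => _) = (fun x => c * expR (pairing 0 x))).
  exact/expspan_scale/expspan_exp.
apply/funext => x; rewrite /pairing big1 ?expR0 ?mulr1// => i _.
by rewrite mxE mul0r.
Qed.

Lemma continuous_pairing v : continuous (pairing v).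
Proof.
apply: continuous_sumr => i; apply: continuous_mulr; first exact: cst_continuous.
exact: coord_continuous.
Qed.

Lemma expspan_continuous f : expspan f -> continuous f.
Proof.
elim=> [v|f1 f2 _ c1 _ c2|c f1 _ c1].
- exact/continuous_expR_comp/continuous_pairing.
- exact: continuous_addr.
- by apply: continuous_mulr => //; exact: cst_continuous.
Qed.

Lemma pairing_le v x : unit_box x -> `|pairing v x| <= \sum_i `|v 0 i|.
Proof.
move=> Kx; apply: (le_trans (ler_norm_sum _ _ _)); apply: ler_sum => i _.
by rewrite normrM ler_piMr// Kx.
Qed.

Lemma expspan_bounded f : expspan f -> exists C, forall x, unit_box x -> `|f x| <= C.
Proof.
elim=> [v|f1 f2 _ [C1 c1] _ [C2 c2]|c f1 _ [C c1]].
- exists (expR (\sum_i `|v 0 i|)) => x Kx.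
  rewrite ger0_norm ?expR_ge0// ler_expR.
  by apply: le_trans (pairing_le v Kx); exact: ler_norm.
- exists (C1 + C2) => x Kx; apply: (le_trans (ler_normD _ _)).
  by rewrite lerD ?c1 ?c2.
- by exists (`|c| * C) => x Kx; rewrite normrM ler_wpM2l// c1.
Qed.

(** The uniform closure of the algebra on the box; stability under absolute values will make it a
    lattice. *)
Definition exp_approx (f : V -> R) : Prop := forall e, 0 < e ->
  exists2 g, expspan g & forall x, unit_box x -> `|f x - g x| <= e.

Lemma exp_approx_span f : expspan f -> exp_approx f.
Proof. by move=> sf e e0; exists f => // x _; rewrite subrr normr0 ltW. Qed.

Lemma exp_approx_lim f :
  (forall e, 0 < e ->
    exists2 g, exp_approx g & forall x, unit_box x -> `|f x - g x| <= e) ->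
  exp_approx f.
Proof.
move=> fg e e0; have e2 : 0 < e / 2 by lra.
have [g ag fge] := fg _ e2; have [h sh ghe] := ag _ e2.
exists h => // x Kx; rewrite (splitr e) (le_trans (ler_distD (g x) _ _))//.
by rewrite lerD ?fge ?ghe.
Qed.

Lemma exp_approx_bounded f :
  exp_approx f -> exists2 C, 0 < C & forall x, unit_box x -> `|f x| <= C.
Proof.
move=> /(_ 1 ltr01)[g sg fg]; have [C gC] := expspan_bounded sg.
exists (`|C| + 1); first by rewrite ltr_wpDl.
move=> x Kx; rewrite -(subrK (g x) (f x)) addrC (le_trans (ler_normD _ _))//.
by rewrite lerD ?fg// (le_trans (gC _ Kx))// ler_norm.
Qed.

Lemma exp_approx_add f g :
  exp_approx f -> exp_approx g -> exp_approx (fun x => f x + g x).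
Proof.
move=> af ag e e0; have e2 : 0 < e / 2 by lra.
have [f' sf ff] := af _ e2; have [g' sg gg] := ag _ e2.
exists (fun x => f' x + g' x); first exact: expspan_add.
move=> x Kx; rewrite opprD addrACA (splitr e) (le_trans (ler_normD _ _))//.
by rewrite lerD ?ff ?gg.
Qed.

Lemma exp_approx_scale c f : exp_approx f -> exp_approx (fun x => c * f x).
Proof.
move=> af e e0; have c0 : 0 < `|c| + 1 by rewrite ltr_wpDl.
have [g sg fg] := af _ (divr_gt0 e0 c0).
exists (fun x => c * g x); first exact: expspan_scale.
move=> x Kx; rewrite -mulrBr normrM.
apply: (@le_trans _ _ ((`|c| + 1) * (e / (`|c| + 1)))).
  by apply: ler_pM => //; [rewrite lerDl|exact: fg].
by rewrite mulrC divfK// gt_eqF.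
Qed.

(** The factors are approximated one at a time: once the first is an exponential sum, its bound
    fixes the precision required of the second. *)
Lemma exp_approx_mul f g :
  exp_approx f -> exp_approx g -> exp_approx (fun x => f x * g x).
Proof.
move=> af ag; apply: exp_approx_lim => e e0.
have [C C0 gC] := exp_approx_bounded ag.
have [f' sf ff] := af _ (divr_gt0 e0 C0).
exists (fun x => f' x * g x).
  move=> d d0; have [C' fC] := expspan_bounded sf.
  have C'0 : 0 < `|C'| + 1 by rewrite ltr_wpDl.
  have [g' sg gg] := ag _ (divr_gt0 d0 C'0).
  exists (fun x => f' x * g' x); first exact: expspan_mul.
  move=> x Kx; rewrite -mulrBr normrM.
  apply: (@le_trans _ _ ((`|C'| + 1) * (d / (`|C'| + 1)))).
    apply: ler_pM => //; last exact: gg.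
    by rewrite (le_trans (fC _ Kx))// (le_trans (ler_norm _))// lerDl.
  by rewrite mulrC divfK// gt_eqF.
move=> x Kx; rewrite -mulrBl normrM -[leRHS](@divfK _ C) ?gt_eqF//.
by apply: ler_pM => //; [exact: ff|exact: gC].
Qed.

(* Polynomials in a^2 which increase to |a| uniformly on [-1, 1]. *)
Fixpoint abs_iter (n : nat) (a : R) : R :=
  if n is n'.+1 then abs_iter n' a + (a * a - abs_iter n' a * abs_iter n' a) / 2
  else 0.

(** With s = |a| and p the current iterate, one step multiplies the error by 1 - (s + p)/2 <= 1 -
    s/2, and (1 - s/2)(1 + (n + 1)s/2) <= 1 + ns/2. The weight grows with s, which gives a rate 2/n
    that stays uniform down to a = 0. *)
Lemma abs_iter_bound n a : `|a| <= 1 ->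
  0 <= abs_iter n a <= `|a| /\
  (`|a| - abs_iter n a) * (1 + n%:R * `|a| / 2) <= `|a|.
Proof.
move=> a1; have a0 := normr_ge0 a.
elim: n => [|n [/andP[p0 pa] IH]]; first by rewrite /= lexx a0; split => //; lra.
rewrite /=; have -> : a * a = `|a| * `|a| by rewrite -normrM ger0_norm// -expr2 sqr_ge0.
move: IH; set s := `|a| in a1 a0 pa *; set p := abs_iter n a in p0 pa * => IH.
have n0 : 0 <= n%:R :> R by [].
have dE : s - (p + (s * s - p * p) / 2) = (s - p) * (1 - (s + p) / 2) by field.
have d0 : 0 <= (s - p) * (1 - (s + p) / 2) by apply: mulr_ge0; lra.
split; first by apply/andP; split; [nra|lra].
rewrite dE; apply: le_trans IH; rewrite -mulrA; apply: ler_wpM2l; first lra.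
rewrite -(natr1 n); have ns : 0 <= n%:R * s by apply: mulr_ge0.
have : (s + p) / 2 >= s / 2 by lra.
move: ns; set q := n%:R * s => ns sp.
have -> : (n%:R + 1) * s / 2 = (q + s) / 2 by rewrite mulrDl mul1r.
apply: (@le_trans _ _ ((1 - s / 2) * (1 + (q + s) / 2))); last by nra.
by apply: ler_wpM2r; lra.
Qed.

Lemma abs_iter_dist n a : `|a| <= 1 -> (0 < n)%N ->
  `| `|a| - abs_iter n a| <= 2 / n%:R.
Proof.
move=> a1 n0; have [/andP[p0 pa] h] := abs_iter_bound n a1.
rewrite ger0_norm ?subr_ge0// ler_pdivlMr ?ltr0n//.
have [a0|a0] := eqVneq `|a| 0.
  move: pa p0; rewrite a0 => pa p0.
  by rewrite (_ : abs_iter n a = 0) ?subrr ?mul0r//; lra.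
have {}a0 : 0 < `|a| by rewrite lt_neqAle eq_sym a0 normr_ge0.
rewrite -(ler_pM2r a0); set s := `|a| in a0 a1 pa h *.
set p := abs_iter n a in p0 pa h *.
move: h; rewrite mulrDr mulr1 -!mulrA; set q := n%:R * _ => h.
have -> : n%:R * s = 2 * q by rewrite /q; field.
by nra.
Qed.

Lemma exp_approx_abs f : exp_approx f -> exp_approx (fun x => `|f x|).
Proof.
move=> af; have [C C0 fC] := exp_approx_bounded af.
pose a x := C^-1 * f x.
have aa : exp_approx a by exact: exp_approx_scale.
have a1 x : unit_box x -> `|a x| <= 1.
  move=> Kx; rewrite normrM gtr0_norm ?invr_gt0// mulrC ler_pdivrMr// mul1r.
  exact: fC.
have ai n : exp_approx (fun x => abs_iter n (a x)).
  elim: n => [|n IH] /=; first exact/exp_approx_span/expspan_cst.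
  apply: exp_approx_add => //.
  rewrite (_ : (fun _ => _) = (fun x => 2^-1 * (a x * a x +
      (-1) * (abs_iter n (a x) * abs_iter n (a x))))); last first.
    by apply/funext => x; rewrite mulN1r mulrC.
  apply: exp_approx_scale; apply: exp_approx_add; first exact: exp_approx_mul.
  exact/exp_approx_scale/exp_approx_mul.
rewrite (_ : (fun _ => _) = (fun x => C * `|a x|)); last first.
  apply/funext => x; rewrite /a normrM gtr0_norm ?invr_gt0// mulrA.
  by rewrite divff ?mul1r// gt_eqF.
apply: exp_approx_scale; apply: exp_approx_lim => e e0.
exists (fun x => abs_iter (Num.truncn (2 / e)).+1 (a x)) => // x Kx.
apply: (le_trans (abs_iter_dist (a1 _ Kx) _)) => //.
rewrite ler_pdivrMr ?ltr0n// mulrC -ler_pdivrMr//.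
by apply: ltW; exact: Num.Theory.truncnS_gt.
Qed.

Lemma exp_approx_min f g :
  exp_approx f -> exp_approx g -> exp_approx (fun x => Num.min (f x) (g x)).
Proof.
move=> af ag; rewrite (_ : (fun _ => _) =
    (fun x => 2^-1 * ((f x + g x) + (-1) * `|f x + (-1) * g x|))); last first.
  by apply/funext => x; rewrite minr_absE !mulN1r mulrC.
apply: exp_approx_scale; apply: exp_approx_add; first exact: exp_approx_add.
apply: exp_approx_scale; apply: exp_approx_abs; apply: exp_approx_add => //.
exact: exp_approx_scale.
Qed.

Lemma exp_approx_sum (J : Type) (r : seq J) (G : J -> V -> R) :
  (forall j, exp_approx (G j)) -> exp_approx (fun x => \sum_(j <- r) G j x).
Proof.
move=> aG; elim: r => [|j r IH].
  by under eq_fun do rewrite big_nil; exact/exp_approx_span/expspan_cst.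
by under eq_fun do rewrite big_cons; exact: exp_approx_add.
Qed.

(** The derivative of [expR] is at least 1/e on [-1, 1]. Distances between coordinates are thus
    dominated by distances between their exponentials, which the algebra can express. *)
Lemma expR_expand (a b : R) : `|a| <= 1 -> `|b| <= 1 ->
  `|a - b| <= expR 1 * `|expR a - expR b|.
Proof.
wlog ab : a b / b <= a => [H a1 b1|].
  have [/H|/ltW/H] := leP b a; first exact.
  by rewrite distrC (distrC (expR a)); exact.
move=> _ /ler_normlP[b1 _]; rewrite !ger0_norm ?subr_ge0 ?ler_expR//.
have -> : expR a - expR b = expR b * (expR (a - b) - 1).
  by rewrite mulrBr mulr1 -expRD (addrC b) subrK.
rewrite mulrA -expRD; have h := expR_ge1Dx (a - b).
apply: (@le_trans _ _ (1 * (expR (a - b) - 1))); first lra.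
apply: ler_wpM2r; first lra.
by rewrite -[leLHS]expR0 ler_expR; lra.
Qed.

(** What the net argument asks of a distance: it vanishes at [x = y], is continuous in [x],
    dominates the norm distance on the box, and lies in the closed algebra as a function of [x]. *)
Definition exp_dist (x y : V) : R :=
  expR 1 * \sum_i `|expR (x 0 i) - expR (y 0 i)|.

Lemma exp_dist_ge x y : unit_box x -> unit_box y -> `|x - y| <= exp_dist x y.
Proof.
move=> Kx Ky; rewrite {1}/Num.norm/= mx_normrE.
have s0 (i : 'I_N) : 0 <= expR 1 * `|expR (x 0 i) - expR (y 0 i)|.
  by rewrite mulr_ge0// expR_ge0.
rewrite /exp_dist mulr_sumr; apply: bigmax_le => [|[i j] _ /=].
  exact: sumr_ge0.
rewrite ord1 !mxE; apply: (le_trans (expR_expand (Kx j) (Ky j))).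
by rewrite (bigD1 j)//= lerDl sumr_ge0.
Qed.

Lemma exp_dist_approx y : exp_approx (exp_dist ^~ y).
Proof.
apply: exp_approx_scale; apply: exp_approx_sum => i; apply: exp_approx_abs.
apply: exp_approx_add; last exact/exp_approx_span/expspan_cst.
rewrite (_ : (fun _ => _) = (fun x => expR (pairing (delta_mx 0 i) x))).
  exact/exp_approx_span/expspan_exp.
apply/funext => x; rewrite /pairing (bigD1 i)//= big1 => [|j ji].
  by rewrite mxE !eqxx mul1r addr0.
by rewrite mxE eqxx (negbTE ji) mul0r.
Qed.

Lemma exp_dist_continuous y : continuous (exp_dist ^~ y).
Proof.
apply: continuous_mulr; first exact: cst_continuous.
apply: continuous_sumr => i; apply: continuous_normr_comp.
apply: continuous_subr; last exact: cst_continuous.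
by apply: continuous_expR_comp; exact: coord_continuous.
Qed.

Lemma unit_box_compact : compact unit_box.
Proof.
rewrite (_ : unit_box =
    [set v : V | forall i, (`[(-1), 1]%classic : set R) (v ord0 i)]).
  by apply: (@rV_compact R N (fun=> `[(-1), 1]%classic)) => i; exact: segment_compact.
apply/seteqP; split => x /= h i; have := h i.
  by rewrite in_itv/= ler_norml.
by rewrite in_itv/= ler_norml.
Qed.

(* [f] is within [e] of the minimum, over a finite net of points [y], of the
   functions [f y + L d(x, y)], where [d] is a distance lying in the closed
   algebra. *)
Lemma exp_approx_lipschitz (f : V -> R) (L : R) : 0 <= L ->
  (forall x y, `|f x - f y| <= L * `|x - y|) -> exp_approx f.
Proof.
move=> L0 fL; have cf : continuous f := lipschitz_continuous fL.
pose psi y x := f y + L * exp_dist x y.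
have psiC y : continuous (psi y).
  apply: continuous_addr; first exact: cst_continuous.
  apply: continuous_mulr; first exact: cst_continuous.
  exact: exp_dist_continuous.
have psi_ge x y : unit_box x -> unit_box y -> f x <= psi y x.
  move=> Kx Ky; have /ler_normlP[_ h] := fL x y.
  have : L * `|x - y| <= L * exp_dist x y by rewrite ler_wpM2l// exp_dist_ge.
  by rewrite /psi; lra.
have psia y : exp_approx (psi y).
  apply: exp_approx_add; first exact/exp_approx_span/expspan_cst.
  exact/exp_approx_scale/exp_dist_approx.
have K0 : unit_box 0 by move=> i; rewrite mxE normr0.
apply: exp_approx_lim => e e0.
pose U y := [set x | psi y x - f x < e].
have oU y : open (U y).
  have /continuousP := continuous_subr (psiC y) cf.
  by move=> /(_ [set z | z < e] (@open_lt _ _)).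
have := unit_box_compact; rewrite compact_cover => /(_ _ unit_box U).
case=> [y _|x Kx|D DK KD]; first exact: oU.
- exists x => //; rewrite /U/= /psi /exp_dist big1 ?mulr0 ?addr0 ?subrr//.
  by move=> i _; rewrite subrr normr0.
have [h [ah fh hpsi]] : exists h, [/\ exp_approx h,
    forall x, unit_box x -> f x <= h x &
    forall y x, y \in finmap.enum_fset D -> unit_box y -> h x <= psi y x].
  (* Induction over the bare list forgets that the net lies in the box, so points outside it are
     skipped; [psi 0] is the value for the empty list. *)
  elim: (finmap.enum_fset D) => [|y s [h [ah fh hpsi]]].
    exists (psi 0); split => //; first by move=> x Kx; exact: psi_ge.
  have [Ky|nKy] := pselect (unit_box y).
    exists (fun x => Num.min (psi y x) (h x)); split.
    - exact: exp_approx_min.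
    - by move=> x Kx; rewrite le_min fh// psi_ge.
    - move=> z x; rewrite inE ge_min => /orP[/eqP ->|zs] Kz; first by rewrite lexx.
      by rewrite hpsi// orbT.
  exists h; split => // z x; rewrite inE => /orP[/eqP -> //|]; exact: hpsi.
exists h => // x Kx; have [y /= yD Uy] := KD _ Kx.
have /set_mem Ky := DK _ yD.
have := hpsi y x yD Ky; have := fh _ Kx; move: Uy; rewrite /U/= => ? ? ?.
by apply/ler_normlP; split; lra.
Qed.

End CramerWold.

Lemma bounded_fun_bound (R : realType) (T : Type) (A : set T) (f : T -> R) :
  [bounded f x | x in A] -> exists2 C, 0 < C & forall x, A x -> `|f x| <= C.
Proof.
move=> [M [_ Mf]]; exists (`|M| + 1); first by rewrite ltr_wpDl.
by move=> x Ax; apply: Mf => //; rewrite (le_lt_trans (ler_norm M))// ltrDl.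
Qed.

Lemma bound_bounded_fun (R : realType) (T : Type) (A : set T) (f : T -> R) C :
  (forall x, A x -> `|f x| <= C) -> [bounded f x | x in A].
Proof.
move=> fC; exists C; split; first exact: num_real.
by move=> D CD x Ax; exact: le_trans (fC _ Ax) (ltW CD).
Qed.

Lemma unit_box_measurable (R : realType) (N : nat) :
  measurable (@unit_box R N : set (borel 'rV[R]_N)).
Proof.
apply: borel_closed_measurable; apply: compact_closed.
  exact: norm_hausdorff.
exact: unit_box_compact.
Qed.

(** Laplace transforms on a compact set determine weak convergence, that of the total mass included
    ([v = 0]). A Lipschitz function is squeezed between [h - d] and [h + d] with [h] in the span, so
    that only the mass [A] of the limit enters the error. *)
Lemma cramer_wold_unit_box (R : realType) (N : nat) (I : Type)
    (F : set_system I) (m_ : I -> {measure set (borel 'rV[R]_N) -> \bar R})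
    (m : {measure set (borel 'rV[R]_N) -> \bar R}) (K := @unit_box R N) :
  Filter F -> (\forall t \near F, (m_ t K < +oo)%E) -> (m K < +oo)%E ->
  (forall v : 'rV[R]_N, \int[m_ t]_(x in K) expR (pairing v x) @[t --> F] -->
    \int[m]_(x in K) expR (pairing v x)) ->
  forall g : 'rV[R]_N -> R, continuous g -> [bounded g x | x in K] ->
  \int[m_ t]_(x in K) g x @[t --> F] --> \int[m]_(x in K) g x.
Proof.
move=> FF m_K mK cvgexp g cg /bounded_fun_bound[C C0 gC].
have mKm : measurable (K : set (borel 'rV[R]_N)) by exact: unit_box_measurable.
have K0 : K !=set0 by exists 0 => i; rewrite mxE normr0.
have intK (mu : {measure set (borel 'rV[R]_N) -> \bar R}) (f : 'rV[R]_N -> R) D :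
    (mu K < +oo)%E -> continuous f -> (forall x, K x -> `|f x| <= D) ->
    mu.-integrable K (EFin \o f).
  move=> muK cf fD; apply: measurable_bounded_integrable => //.
    apply: borel_within_continuous_measurable => //; exact: continuous_subspaceT.
  exact: bound_bounded_fun fD.
have intspan (mu : {measure set (borel 'rV[R]_N) -> \bar R}) f :
    (mu K < +oo)%E -> expspan f -> mu.-integrable K (EFin \o f).
  move=> muK sf; have [D fD] := expspan_bounded sf.
  exact: (intK _ _ D muK (expspan_continuous sf) fD).
have cvgspan f : expspan f ->
    \int[m_ t]_(x in K) f x @[t --> F] --> \int[m]_(x in K) f x.
  elim=> [v|f1 f2 s1 IH1 s2 IH2|c f1 s1 IH1]; first exact: cvgexp.
    rewrite RintegralD//; [|exact: intspan|exact: intspan].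
    apply: (@cvg_trans _
      ((fun t => \int[m_ t]_(x in K) f1 x + \int[m_ t]_(x in K) f2 x) @ F)).
      apply: near_eq_cvg; near=> t.
      by rewrite RintegralD//; apply: intspan => //; near: t.
    exact: (@cvgD _ R^o).
  rewrite RintegralZl//; [|exact: intspan].
  apply: (@cvg_trans _ ((fun t => c * \int[m_ t]_(x in K) f1 x) @ F)).
    apply: near_eq_cvg; near=> t.
    by rewrite RintegralZl//; apply: intspan => //; near: t.
  by apply: cvgM => //; exact: cvg_cst.
pose A := fine (m K); have A0 : 0 <= A by exact: fine_ge0.
apply: (@cvg_Rintegral_lipschitz R _ K I F m_ m (cst C) g C 0) => //.
- by move=> x y; rewrite subrr normr0 mul0r.
- by move=> x; rewrite lexx ltW.
- near=> t; have ht : (m_ t K < +oo)%E by near: t.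
  apply: (intK _ _ C ht); first exact: cst_continuous.
  by move=> x _; rewrite ger0_norm// ltW.
- apply: (intK _ _ C mK); first exact: cst_continuous.
  by move=> x _; rewrite ger0_norm// ltW.
- move=> phi c phic phi0C _.
  have af : exp_approx phi.
    apply: (@exp_approx_lipschitz _ _ _ `|c|) => // x y.
    by apply: (le_trans (phic x y)); rewrite ler_wpM2r// ler_norm.
  have cphi := lipschitz_continuous phic.
  have iphi (mu : {measure set (borel 'rV[R]_N) -> \bar R}) :
      (mu K < +oo)%E -> mu.-integrable K (EFin \o phi).
    move=> muK; apply: (intK _ _ (C *+ 2)) => // x _.
    by have /andP[p0 p1] := phi0C x; rewrite ger0_norm.
  have AE r : \int[m]_(x in K) r = r * A by rewrite Rintegral_cst.
  apply: cvg_sandwich => e e0.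
    (* With this value as [d], the gap [2 d] costs at most [e A / (A + 1)]; the [+ 1] covers
       [A = 0]. *)
    have e1 : 0 < e / (A + 1) / 2 by rewrite !divr_gt0// ltr_wpDl.
    have [h sh hphi] := af _ e1; set d := _ / 2 in e1 hphi.
    have sg : expspan (fun x => h x + - d) by apply: expspan_add => //; exact: expspan_cst.
    exists (fun t => \int[m_ t]_(x in K) (h x + - d)), (\int[m]_(x in K) (h x + - d)); split.
    + exact: cvgspan sg.
    + rewrite lerBlDr; apply: (@le_trans _ _ (\int[m]_(x in K) ((h x + - d) + d *+ 2))).
        apply: le_Rintegral => //; [exact: iphi| |].
          apply: intspan => //; apply: expspan_add => //; exact: expspan_cst.
        by move=> x Kx; have /ler_normlP[? ?] := hphi x Kx; lra.
      rewrite RintegralD//; [|exact: intspan|exact: (intspan _ _ mK (expspan_cst _ _))].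
      rewrite lerD2l AE -mulr_natr /d divfK// mulrC.
      rewrite mulrA ler_pdivrMr ?ltr_wpDl//; nra.
    + near=> t; have ht : (m_ t K < +oo)%E by near: t.
      apply: le_Rintegral => //; [exact: intspan|exact: iphi|].
      by move=> x Kx; have /ler_normlP[? ?] := hphi x Kx; lra.
  have e1 : 0 < e / (A + 1) / 2 by rewrite !divr_gt0// ltr_wpDl.
  have [h sh hphi] := af _ e1; set d := _ / 2 in e1 hphi.
  have sg : expspan (fun x => h x + d) by apply: expspan_add => //; exact: expspan_cst.
  exists (fun t => \int[m_ t]_(x in K) (h x + d)), (\int[m]_(x in K) (h x + d)); split.
  + exact: cvgspan sg.
  + apply: (@le_trans _ _ (\int[m]_(x in K) (phi x + d *+ 2))).
      apply: le_Rintegral => //; [exact: intspan| |].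
        apply: (intK _ _ (C *+ 2 + d *+ 2) mK).
          by apply: continuous_addr => //; exact: cst_continuous.
        by move=> x _; have /andP[p0 p1] := phi0C x; rewrite ger0_norm; lra.
      by move=> x Kx; have /ler_normlP[? ?] := hphi x Kx; lra.
    rewrite RintegralD//; [|exact: iphi|exact: (intspan _ _ mK (expspan_cst _ _))].
    rewrite lerD2l AE -mulr_natr /d divfK// mulrC.
    rewrite mulrA ler_pdivrMr ?ltr_wpDl//; nra.
  + near=> t; have ht : (m_ t K < +oo)%E by near: t.
    apply: le_Rintegral => //; [exact: iphi|exact: intspan|].
    by move=> x Kx; have /ler_normlP[? ?] := hphi x Kx; lra.
- exact: continuous_subspaceT.
Unshelve. all: by end_near. Qed.

(** * Coordinates in a Hilbert space *)

Section Hilbert.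
Context (R : realType) (H : normedModType R) (dot : {dot H for idfun}).
Hypothesis dot_norm : norm_induced_by dot.

Lemma dotC x y : dot x y = dot y x.
Proof. by have := @hermitian_subproof _ _ _ _ dot x y; rewrite expr0 mul1r. Qed.

Lemma dotDl x y z : dot (x + y) z = dot x z + dot y z.
Proof. exact: linearDl. Qed.

Lemma dotZl a x z : dot (a *: x) z = a * dot x z.
Proof. exact: linearZl_LR. Qed.

Lemma dotDr x y z : dot z (x + y) = dot z x + dot z y.
Proof. by rewrite dotC dotDl !(dotC z). Qed.

Lemma dotZr a x z : dot z (a *: x) = a * dot z x.
Proof. by rewrite dotC dotZl (dotC z). Qed.

Lemma dot0l z : dot 0 z = 0.
Proof. by rewrite -(scale0r 0) dotZl mul0r. Qed.

Lemma dot_suml n (G : 'I_n -> H) z : dot (\sum_i G i) z = \sum_i dot (G i) z.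
Proof.
elim/big_rec2 : _ => [|i x y _ <-]; first exact: dot0l.
by rewrite dotDl.
Qed.

Lemma dot_ge0 x : 0 <= dot x x.
Proof.
have [->|x0] := eqVneq x 0; first by rewrite dot0l.
by apply: ltW; exact: neq0_dnorm_gt0.
Qed.

Lemma normr_sqr x : `|x| ^+ 2 = dot x x.
Proof. by rewrite dot_norm sqr_sqrtr// dot_ge0. Qed.

Lemma dot_polarization x y :
  dot x y = (`|x + y| ^+ 2 - `|x| ^+ 2 - `|y| ^+ 2) / 2.
Proof.
rewrite !normr_sqr dotDl !dotDr (dotC y x); lra.
Qed.

(** Polarization builds the inner product from norms, so continuity of the norm is enough. *)
Lemma dot_continuous h : continuous (dot ^~ h).
Proof.
have nc (f : H -> H) : continuous f -> continuous (fun x => `|f x| ^+ 2).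
  move=> cf; have cn : continuous (fun x => `|f x|).
    move=> x; apply: (@continuous_comp H H R f (fun z => `|z|)); first exact: cf.
    exact: norm_continuous.
  by under eq_fun do rewrite expr2; exact: continuous_mulr.
rewrite (_ : dot ^~ h = fun x => (`|x + h| ^+ 2 - `|x| ^+ 2 - `|h| ^+ 2) * 2^-1).
  apply: continuous_mulr; last exact: cst_continuous.
  apply: continuous_subr; last exact: cst_continuous.
  apply: continuous_subr; last by apply: nc => x; exact: cvg_id.
  by apply: nc => x; apply: cvgD; [exact: cvg_id|exact: cvg_cst].
by apply/funext => x; rewrite dot_polarization.
Qed.

Context (e : nat -> H).
Hypothesis basis_e : orthonormal_basis dot e.

Definition synthesis (N : nat) (v : 'rV[R]_N) : H := \sum_(i < N) v 0 i *: e i.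

Lemma synthesis_dist N (v w : 'rV[R]_N) :
  `|synthesis v - synthesis w| <= N%:R * `|v - w|.
Proof.
rewrite /synthesis -sumrB; apply: (le_trans (ler_norm_sum _ _ _)).
apply: (@le_trans _ _ (\sum_(i < N) `|v - w|)); last first.
  by rewrite sumr_const card_ord mulr_natl.
apply: ler_sum => i _; rewrite -scalerBl normrZ.
have -> : `|e i| = 1 by rewrite dot_norm basis_e.1 eqxx sqrtr1.
rewrite mulr1 [leRHS]/Num.norm/= mx_normrE.
rewrite (_ : v 0 i - w 0 i = (v - w) 0 i); last by rewrite !mxE.
exact: (le_bigmax _ (fun ij : 'I_1 * 'I_N => `|(v - w) ij.1 ij.2|) (0, i)).
Qed.

(** [synthesis] is the adjoint of [coordinates]: a linear functional of the first [N] coordinates is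
    the inner product with one vector. This is the link between convergence for every [h] and
    convergence of the coordinates. *)
Lemma dot_synthesis N (v : 'rV[R]_N) x :
  dot x (synthesis v) = pairing v (coordinates dot e N x).
Proof.
rewrite dotC dot_suml; apply: eq_bigr => i _.
by rewrite dotZl mxE dotC.
Qed.

Lemma coordinates_continuous N : continuous (coordinates dot e N).
Proof.
move=> x; apply/cvgrPdist_le => d d0.
have h : \forall y \near x, forall i : 'I_N, `|dot x (e i) - dot y (e i)| <= d.
  apply: filter_forall => i.
  by have /cvgrPdist_le/(_ _ d0) := @dot_continuous (e i) x.
near=> y; rewrite [leLHS]/Num.norm/= mx_normrE; apply: bigmax_le; first exact: ltW.
move=> [i j] _ /=; rewrite !mxE; move: j; near: y; exact: h.
Unshelve. all: by end_near. Qed.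

(** Pythagoras: the projection [y] satisfies [dot x y = dot y y], both being the sum of the squared
    coordinates. *)
Lemma projection_dist N x :
  `|x - synthesis (coordinates dot e N x)| ^+ 2 =
  `|x| ^+ 2 - \sum_i coordinates dot e N x 0 i ^+ 2.
Proof.
set s := \sum_i _; set y := synthesis _.
have xy : dot x y = s.
  by rewrite dot_synthesis; apply: eq_bigr => i _; rewrite expr2.
have yy : dot y y = s.
  rewrite dot_suml; apply: eq_bigr => i _.
  rewrite dotZl expr2; congr (_ * _); rewrite dotC dot_suml (bigD1 i)//=.
  rewrite dotZl basis_e.1 eqxx mulr1 big1 ?addr0// => j ji.
  by rewrite dotZl basis_e.1 [_ == _](negbTE ji) mulr0.
rewrite -scaleN1r !normr_sqr dotDl !dotDr !dotZl !dotZr (dotC y) xy yy; ring.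
Qed.

Lemma bessel N x : \sum_i coordinates dot e N x 0 i ^+ 2 <= `|x| ^+ 2.
Proof. by rewrite -subr_ge0 -projection_dist sqr_ge0. Qed.

Lemma coordinates_unit_box N x : `|x| <= 1 -> unit_box (coordinates dot e N x).
Proof.
move=> x1 i; rewrite -(@expr_le1 _ 2)// -normrX ger0_norm ?sqr_ge0//.
have := bessel N x; rewrite (bigD1 i)//= => h.
have s0 : 0 <= \sum_(j < N | j != i) coordinates dot e N x 0 j ^+ 2.
  by apply: sumr_ge0 => j _; exact: sqr_ge0.
have : `|x| ^+ 2 <= 1 by rewrite expr_le1.
by lra.
Qed.

Lemma projection_cvg x :
  `|x - synthesis (coordinates dot e N x)| @[N --> \oo] --> (0 : R).
Proof.
have := basis_e.2 x => /cvgrPdist_le h; apply/cvgrPdist_le => d d0.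
have := h _ d0; apply: filterS => n; rewrite sub0r normrN normr_id.
rewrite /synthesis; congr (`|_ - _| <= _).
by apply: eq_bigr => i _; rewrite mxE.
Qed.

End Hilbert.

(** * Weak convergence on the unit sphere *)

Section ImageMeasure.
Context d d' (T : measurableType d) (U : measurableType d') (R : realType).
Context (m : {measure set T -> \bar R}) (f : T -> U).
Hypothesis mf : measurable_fun setT f.

Definition image_measure : {measure set U -> \bar R} :=
  ltac:(unshelve refine (pushforward m f : {measure set U -> \bar R}); exact mf).

Lemma image_measureE A : image_measure A = m (f @^-1` A).
Proof. by []. Qed.

Lemma integral_image (D : set U) (g : U -> R) :
  measurable D -> measurable_fun D g ->
  m.-integrable (f @^-1` D) (EFin \o (g \o f)) ->
  (\int[image_measure]_(x in D) (g x)%:E = \int[m]_(x in f @^-1` D) (g (f x))%:E)%E.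
Proof.
(* Extension by zero turns [g], known to be measurable on [D], into a function measurable
   everywhere, to which the change of variables applies. *)
move=> mD mg ig; have fE x : (f @^-1` D) x -> (g \_ D) (f x) = g (f x).
  by move=> Dx; rewrite patchT// inE.
transitivity (\int[image_measure]_(x in D) ((g \_ D) x)%:E)%E.
  by apply: eq_integral => x Dx; rewrite patchT.
transitivity (\int[m]_(x in f @^-1` D) ((g \_ D) (f x))%:E)%E; last first.
  by apply: eq_integral => x; rewrite inE => Dx; rewrite fE.
apply: (@integral_pushforward _ _ _ _ _ _ mf m D (EFin \o (g \_ D))) => //.
  by apply/measurable_EFinP; exact/(measurable_restrictT _ mD).
apply: eq_integrable ig => //.
  by rewrite -[X in measurable X]setTI; exact: mf.
by move=> x; rewrite inE => Dx /=; rewrite fE.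
Qed.

Lemma Rintegral_image (D : set U) (g : U -> R) :
  measurable D -> measurable_fun D g ->
  m.-integrable (f @^-1` D) (EFin \o (g \o f)) ->
  \int[image_measure]_(x in D) g x = \int[m]_(x in f @^-1` D) g (f x).
Proof. by move=> mD mg ig; rewrite /Rintegral integral_image. Qed.

End ImageMeasure.

Lemma Rintegral_carried d (T : measurableType d) (R : realType)
    (mu : {measure set T -> \bar R}) (S D : set T) (f : T -> R) :
  measurable S -> measurable D -> S `<=` D -> mu (~` S) = 0%E ->
  mu.-integrable D (EFin \o f) ->
  \int[mu]_(x in D) f x = \int[mu]_(x in S) f x.
Proof.
move=> mS mD SD S0 intf; congr fine.
rewrite (@negligible_integral _ _ _ _ D (~` S))//; last exact: measurableC.
by rewrite setDE setCK setIidr.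
Qed.

Lemma unit_sphere_closed (R : realType) (H : normedModType R) :
  closed (unit_sphere H).
Proof.
rewrite (_ : unit_sphere H = (fun x => `|x|) @^-1` [set 1]); last by [].
apply: (closed_comp (f := fun x : H => `|x|)); last exact: closed_eq.
by move=> x _; exact: norm_continuous.
Qed.

Lemma unit_sphere_measurable (R : realType) (H : normedModType R) :
  measurable (unit_sphere H : set (borel H)).
Proof. by apply: borel_closed_measurable; exact: unit_sphere_closed. Qed.

Section SphereConvergence.
Context (R : realType) (H : normedModType R) (dot : {dot H for idfun}).
Hypothesis dot_norm : norm_induced_by dot.
Context (e : nat -> H).
Hypothesis basis_e : orthonormal_basis dot e.
Context (I : Type) (F : set_system I) (FF : Filter F).
Context (nu_ : I -> {measure set (borel H) -> \bar R})
  (nu : {measure set (borel H) -> \bar R}).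
Local Notation S := (unit_sphere H : set (borel H)).
Hypothesis nu_fin : (nu setT < +oo)%E.
Hypothesis nuS : nu (~` S) = 0%E.
Hypothesis nu_S : \forall t \near F, (nu_ t setT < +oo)%E /\ nu_ t (~` S) = 0%E.

Let mS : measurable S := @unit_sphere_measurable R H.

Let fin_sub (mu : {measure set (borel H) -> \bar R}) (D : set (borel H)) :
  (mu setT < +oo)%E -> measurable D -> (mu D < +oo)%E.
Proof. by move=> h mD; apply: le_lt_trans h; apply: le_measure; rewrite ?inE. Qed.

Let int_sub (mu : {measure set (borel H) -> \bar R}) (D : set (borel H)) f C :
  (mu setT < +oo)%E -> measurable D -> continuous (f : H -> R) ->
  (forall x, D x -> `|f x| <= C) -> mu.-integrable D (EFin \o f).
Proof.
move=> h mD cf fC; apply: measurable_bounded_integrable => //.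
- exact: fin_sub.
- by apply: borel_within_continuous_measurable => //; exact: continuous_subspaceT.
- exact: bound_bounded_fun fC.
Qed.

(** By Bessel's inequality the coordinates map the sphere into the unit box, where exponentials of
    linear functionals are enough. *)
Lemma ridge_coordinates_cvg N (g : 'rV[R]_N -> R) :
  (forall (h : H) (g : R -> R), continuous g -> [bounded g x | x in setT] ->
    \int[nu_ t]_(x in S) g (dot x h) @[t --> F] --> \int[nu]_(x in S) g (dot x h)) ->
  continuous g -> [bounded g x | x in setT] ->
  \int[nu_ t]_(x in S) g (coordinates dot e N x) @[t --> F] -->
  \int[nu]_(x in S) g (coordinates dot e N x).
Proof.
move=> ridge cg bg; pose c : borel H -> borel 'rV[R]_N := coordinates dot e N.
have cc : continuous (coordinates dot e N) := @coordinates_continuous _ _ _ dot_norm e N.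
have mc : measurable_fun setT c by exact: borel_continuous_measurable_map.
pose K : set (borel 'rV[R]_N) := @unit_box R N.
have mK : measurable K := @unit_box_measurable R N.
have mcK : measurable (c @^-1` K) by rewrite -[X in measurable X]setTI; exact: mc.
have ScK : S `<=` c @^-1` K.
  by move=> x Sx; apply: coordinates_unit_box => //; rewrite Sx.
have pushE (mu : {measure set (borel H) -> \bar R}) (f : 'rV[R]_N -> R) C :
    (mu setT < +oo)%E -> mu (~` S) = 0%E -> continuous f ->
    (forall x, K x -> `|f x| <= C) ->
    \int[image_measure mu mc]_(x in K) f x = \int[mu]_(x in S) f (c x).
  move=> muT muS cf fC.
  have ifc : mu.-integrable (c @^-1` K) (EFin \o (f \o c)).
    apply: (@int_sub _ _ _ C) => //.
    - move=> x; apply: (@continuous_comp H 'rV[R]_N R); [exact: cc|exact: cf].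
    - by move=> x /fC.
  rewrite Rintegral_image//; last first.
    by apply: borel_within_continuous_measurable => //; exact: continuous_subspaceT.
  exact: Rintegral_carried.
have cw := @cramer_wold_unit_box R N I F (fun t => image_measure (nu_ t) mc)
  (image_measure nu mc) FF.
have [C C0 gC] := bounded_fun_bound bg.
have gKC x : K x -> `|g x| <= C by move=> _; exact: gC.
have ptr (f : 'rV[R]_N -> R) D : continuous f -> (forall x, K x -> `|f x| <= D) ->
    \int[nu_ t]_(x in S) f (c x) @[t --> F] --> \int[nu]_(x in S) f (c x) <->
    \int[image_measure (nu_ t) mc]_(x in K) f x @[t --> F] -->
    \int[image_measure nu mc]_(x in K) f x.
  move=> cf fD; rewrite (pushE _ _ D)//.
  have E : \forall t \near F, \int[nu_ t]_(x in S) f (c x) =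
      \int[image_measure (nu_ t) mc]_(x in K) f x.
    near=> t; have [h1 h2] : (nu_ t setT < +oo)%E /\ nu_ t (~` S) = 0%E by near: t.
    by rewrite (pushE _ _ D).
  split; apply: cvg_trans; apply: near_eq_cvg; first exact: E.
  by apply: filterS E => t ->.
apply/(ptr _ C) => //; apply: cw => //.
- near=> t; have [h1 h2] : (nu_ t setT < +oo)%E /\ nu_ t (~` S) = 0%E by near: t.
  by rewrite image_measureE; exact: fin_sub.
- by rewrite image_measureE; exact: fin_sub.
- move=> v; pose B := \sum_i `|v 0 i|.
  apply/(ptr _ (expR B)).
  + exact/continuous_expR_comp/continuous_pairing.
  + move=> x Kx; rewrite ger0_norm ?expR_ge0// ler_expR.
    by apply: le_trans (pairing_le v Kx); exact: ler_norm.
  (* The exponential is unbounded on the line, whereas [ridge] speaks of bounded functions. [B]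
     bounds the pairing on the box, so clipping at [B] changes nothing on the sphere. *)
  pose clip z := Num.min z B.
  have E (mu : {measure set (borel H) -> \bar R}) :
      \int[mu]_(x in S) expR (pairing v (c x)) =
      \int[mu]_(x in S) expR (clip (dot x (synthesis e v))).
    apply: eq_Rintegral => x; rewrite inE => Sx.
    rewrite dot_synthesis /clip min_l//.
    have /ler_normlP[] // := pairing_le v (ScK _ Sx).
  under eq_fun do rewrite E.
  rewrite E; apply: (ridge (synthesis e v) (fun z => expR (clip z))).
  + apply: continuous_expR_comp => z; apply: (@continuous_min R R^o id (cst B)).
      exact: cvg_id.
    exact: cvg_cst.
  + apply: (@bound_bounded_fun _ _ _ _ (expR B)) => z _.
    by rewrite ger0_norm ?expR_ge0// ler_expR /clip ge_min lexx orbT.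
- by apply: (@bound_bounded_fun _ _ _ _ C).
Unshelve. all: by end_near. Qed.

(** On the sphere this is the squared norm of the remainder, expressed through the coordinates
    alone. The maximum with 0 keeps it in [0, 1] on all of R^N, since test functions of the
    coordinates must be bounded everywhere. *)
Let tail N (v : 'rV[R]_N) : R := Num.max 0 (1 - \sum_i v 0 i ^+ 2).

Let tail_continuous N : continuous (@tail N).
Proof.
move=> v; apply: (@continuous_max R 'rV[R]_N (cst 0) _ v); first exact: cst_continuous.
apply: continuous_subr; first exact: cst_continuous.
apply: continuous_sumr => i; under eq_fun do rewrite expr2.
by apply: continuous_mulr; exact: coord_continuous.
Qed.

Let tail01 N (v : 'rV[R]_N) : 0 <= tail v <= 1.
Proof.
rewrite le_max lexx/= ge_max ler01/= gerBl.
by apply: sumr_ge0 => i _; exact: sqr_ge0.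
Qed.

Let tailE N x : S x -> tail (coordinates dot e N x) =
  `|x - synthesis e (coordinates dot e N x)| ^+ 2.
Proof.
move=> Sx; rewrite (projection_dist dot_norm basis_e) Sx expr1n /tail.
apply: max_r; rewrite subr_ge0; have := bessel dot_norm basis_e N x.
by rewrite Sx expr1n.
Qed.

Let synthesis_lipschitz_continuous N (phi : H -> R) c :
  (forall x y, `|phi x - phi y| <= c * `|x - y|) -> 0 <= c ->
  continuous (fun v : 'rV[R]_N => phi (synthesis e v)).
Proof.
move=> phic c0; apply: (@lipschitz_continuous _ _ _ (c * N%:R)) => v w.
apply: (le_trans (phic _ _)); rewrite -mulrA ler_wpM2l//.
exact: synthesis_dist.
Qed.

(* The coordinates control the norm of the remainder [x - p_N x] because
   |x| = 1 on the sphere: this replaces a tightness argument. *)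
Lemma coordinates_weak_cvg :
  S !=set0 ->
  (forall N (g : 'rV[R]_N -> R), (1 <= N)%N -> continuous g ->
    [bounded g x | x in setT] ->
    \int[nu_ t]_(x in S) g (coordinates dot e N x) @[t --> F] -->
    \int[nu]_(x in S) g (coordinates dot e N x)) ->
  forall f : H -> R, {within S, continuous f} -> [bounded f x | x in S] ->
  \int[nu_ t]_(x in S) f x @[t --> F] --> \int[nu]_(x in S) f x.
Proof.
move=> S0 fidi f cf /bounded_fun_bound[C C0 fC].
have int_cst (mu : {measure set (borel H) -> \bar R}) r :
    (mu setT < +oo)%E -> mu.-integrable S (EFin \o cst r).
  by move=> h; apply: (@int_sub _ _ _ `|r| h mS) => //; exact: cst_continuous.
apply: (@cvg_Rintegral_lipschitz R H S I F nu_ nu (cst C) f C 0) => //.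
- by move=> x y; rewrite subrr normr0 mul0r.
- by move=> x; rewrite lexx ltW.
- near=> t; have [h1 h2] : (nu_ t setT < +oo)%E /\ nu_ t (~` S) = 0%E by near: t.
  exact: int_cst.
- exact: int_cst.
move=> phi c' phic' phi0C _; pose c := `|c'| + 1.
have c0 : 0 < c by rewrite /c ltr_wpDl.
have phic x y : `|phi x - phi y| <= c * `|x - y|.
  apply: (le_trans (phic' x y)); rewrite ler_wpM2r// (le_trans (ler_norm _))//.
  by rewrite lerDl.
have cphi := lipschitz_continuous phic.
pose crd N x := coordinates dot e N x.
have ccrd N : continuous (crd N) := @coordinates_continuous _ _ _ dot_norm e N.
have ctail N : continuous (fun x => tail (crd N x)).
  move=> x; apply: (@continuous_comp H 'rV[R]_N R); first exact: ccrd.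
  exact: tail_continuous.
(* From a <= eta + a^2 / eta, with [a] the norm of the remainder: the distance is traded for its
   square, which is what [tail] provides. *)
pose err N eta x := c * eta + c / eta * tail (crd N x).
have near_proj N eta x : 0 < eta -> S x ->
    `|phi x - phi (synthesis e (crd N x))| <= err N eta x.
  move=> eta0 Sx; apply: (le_trans (phic _ _)); rewrite /err tailE//.
  set a := `|_ - _|; rewrite -[c / eta * _]mulrA -mulrDr ler_pM2l//.
  have a0 : 0 <= a by exact: normr_ge0.
  rewrite -(ler_pM2r eta0) mulrDl mulrAC mulVf ?gt_eqF// mul1r expr2.
  by have := sqr_ge0 (a - eta); rewrite expr2; nra.
have err0 N eta x : 0 < eta -> 0 <= err N eta x.
  move=> eta0; have /andP[t0 _] := tail01 (crd N x).
  by rewrite addr_ge0// mulr_ge0// ?divr_ge0 ?ltW.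
have errC N eta x : 0 < eta -> err N eta x <= c * eta + c / eta.
  move=> eta0; have /andP[_ t1] := tail01 (crd N x).
  by rewrite lerD2l ler_piMr// divr_ge0// ltW.
have cerr N eta : continuous (err N eta).
  apply: continuous_addr; first exact: cst_continuous.
  by apply: continuous_mulr; first exact: cst_continuous.
have ierr (mu : {measure set (borel H) -> \bar R}) N eta : 0 < eta ->
    (mu setT < +oo)%E -> mu.-integrable S (EFin \o err N eta).
  move=> eta0 h; apply: (@int_sub _ _ _ (c * eta + c / eta) h mS) => // x _.
  by rewrite ger0_norm ?err0// errC.
have iphi (mu : {measure set (borel H) -> \bar R}) :
    (mu setT < +oo)%E -> mu.-integrable S (EFin \o phi).
  move=> h; apply: (@int_sub _ _ _ (C *+ 2) h mS) => // x _.
  by have /andP[? ?] := phi0C x; rewrite ger0_norm.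
have cproj N : continuous (fun x => phi (synthesis e (crd N x))).
  move=> x; apply: (@continuous_comp H 'rV[R]_N R (crd N) (fun v => phi (synthesis e v))).
    exact: ccrd.
  exact: (synthesis_lipschitz_continuous phic (ltW c0)).
have iproj (mu : {measure set (borel H) -> \bar R}) N :
    (mu setT < +oo)%E ->
    mu.-integrable S (EFin \o (fun x => phi (synthesis e (crd N x)))).
  move=> h; apply: (@int_sub _ _ _ (C *+ 2) h mS) => // x _.
  by have /andP[? ?] := phi0C (synthesis e (crd N x)); rewrite ger0_norm.
(* The basis expansion gives convergence to 0 at each point of the sphere, and the constant 1
   dominates. *)
have tail_cvg : \int[nu]_(x in S) tail (crd N x) @[N --> \oo] --> (0 : R).
  rewrite [X in _ --> X](_ : 0 = \int[nu]_(x in S) (cst 0 x)); last first.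
    by rewrite Rintegral_cst ?mul0r.
  apply: (@Rintegral_dominated_cvg _ _ _ nu S _ _ (cst 1)) => //.
  - move=> N; apply: borel_within_continuous_measurable => //.
    exact: continuous_subspaceT.
  - move=> x Sx /=; under eq_fun do rewrite tailE//.
    under eq_fun do rewrite expr2; have p0 := projection_cvg basis_e x.
    by have := cvgM p0 p0; rewrite mul0r; exact.
  - exact: (int_cst _ 1 nu_fin).
  - by move=> N x _; have /andP[? ?] := tail01 (crd N x); rewrite ger0_norm.
pose A := fine (nu S); have A0 : 0 <= A by exact: fine_ge0.
have small d : 0 < d -> exists2 eta, 0 < eta & exists2 N, (1 <= N)%N &
    \int[nu]_(x in S) err N eta x <= d.
  move=> d0; have cA : 0 < c * (A + 1) *+ 2.
    by rewrite mulrn_wgt0// mulr_gt0// ltr_wpDl.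
  (* The order matters: [eta] first makes the constant part of the error at most [d / 2]; only then
     is [N] taken large enough to beat the factor [c / eta]. *)
  pose eta := d / (c * (A + 1) *+ 2); have eta0 : 0 < eta by rewrite divr_gt0.
  exists eta => //; have ce0 : 0 < c / eta by rewrite divr_gt0.
  have d1 : 0 < d / 2 / (c / eta) by rewrite !divr_gt0.
  move/cvgrPdist_le : tail_cvg => /(_ _ d1)[n _ nN].
  exists n.+1 => //; have := nN n.+1 (leqnSn n); rewrite /= sub0r normrN => h.
  have it : nu.-integrable S (EFin \o (fun x => tail (crd n.+1 x))).
    apply: (@int_sub _ _ _ 1 nu_fin mS) => // x _.
    by have /andP[? ?] := tail01 (crd n.+1 x); rewrite ger0_norm.
  rewrite /err RintegralD//; last 2 first.
  - exact: int_cst.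
  - apply: (@int_sub _ _ _ (c / eta) nu_fin mS) => [|x _].
      by apply: continuous_mulr; first exact: cst_continuous.
    have /andP[? ?] := tail01 (crd n.+1 x).
    have ct0 : 0 <= c / eta * tail (crd n.+1 x) by rewrite mulr_ge0// ltW.
    by rewrite ger0_norm// ler_piMr// ltW.
  rewrite (Rintegral_cst nu mS (c * eta)) RintegralZl// -/A.
  have {}h : c / eta * \int[nu]_(x in S) tail (crd n.+1 x) <= d / 2.
    by rewrite mulrC -ler_pdivlMr//; exact: le_trans (ler_norm _) h.
  have : c * eta * A <= d / 2.
    have -> : d / 2 = c * eta * (A + 1).
      have : eta * (c * (A + 1) *+ 2) = d by rewrite divfK// gt_eqF.
      by rewrite -mulr_natr; nra.
    by rewrite ler_wpM2l ?lerDl// mulr_ge0// ltW.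
  by lra.
(* Taken with [s] equal to -1 and 1: the lower and the upper bound are both functions of the
   coordinates, so [fidi] applies to them. *)
have cvgG (s : R) N eta : 0 < eta -> (1 <= N)%N ->
    \int[nu_ t]_(x in S) (phi (synthesis e (crd N x)) + s * err N eta x) @[t --> F] -->
    \int[nu]_(x in S) (phi (synthesis e (crd N x)) + s * err N eta x).
  move=> eta0 N1; apply: (fidi N (fun v => phi (synthesis e v) +
      s * (c * eta + c / eta * tail v)) N1).
    apply: continuous_addr.
      exact: (synthesis_lipschitz_continuous phic (ltW c0)).
    apply: continuous_mulr; first exact: cst_continuous.
    apply: continuous_addr; first exact: cst_continuous.
    by apply: continuous_mulr; [exact: cst_continuous|exact: tail_continuous].
  apply: (@bound_bounded_fun _ _ _ _ (C *+ 2 + `|s| * (c * eta + c / eta))) => v _.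
  apply: (le_trans (ler_normD _ _)); apply: lerD.
    by have /andP[? ?] := phi0C (synthesis e v); rewrite ger0_norm.
  rewrite normrM ler_wpM2l//; have /andP[t0 t1] := tail01 v.
  have ce0 : 0 < c / eta by rewrite divr_gt0.
  have ct0 : 0 <= c / eta * tail v by rewrite mulr_ge0// ltW.
  rewrite ger0_norm; last by rewrite addr_ge0// mulr_ge0// ltW.
  by rewrite lerD2l ler_piMr// ltW.
have iG (mu : {measure set (borel H) -> \bar R}) (s : R) N eta : 0 < eta ->
    (mu setT < +oo)%E -> mu.-integrable S
      (EFin \o (fun x => phi (synthesis e (crd N x)) + s * err N eta x)).
  move=> eta0 h.
  apply: (@int_sub _ _ _ (C *+ 2 + `|s| * (c * eta + c / eta)) h mS) => [|x _].
    by apply: continuous_addr => //; apply: continuous_mulr => //; exact: cst_continuous.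
  apply: (le_trans (ler_normD _ _)); apply: lerD.
    by have /andP[? ?] := phi0C (synthesis e (crd N x)); rewrite ger0_norm.
  by rewrite normrM ler_wpM2l// ger0_norm ?err0// errC.
have err2 N eta : 0 < eta ->
    \int[nu]_(x in S) (err N eta x *+ 2) = (\int[nu]_(x in S) err N eta x) *+ 2.
  move=> eta0; under eq_Rintegral do rewrite -mulr_natl.
  by rewrite RintegralZl ?mulr_natl//; exact: ierr.
have ierr2 N eta : 0 < eta -> nu.-integrable S (EFin \o (fun x => err N eta x *+ 2)).
  move=> eta0; apply: (@int_sub _ _ _ ((c * eta + c / eta) *+ 2) nu_fin mS) => [|x _].
    by under eq_fun do rewrite mulr2n; exact: continuous_addr.
  by rewrite ger0_norm ?mulrn_wge0 ?err0// lerMn2r errC.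
apply: cvg_sandwich => d d0; have d2 : 0 < d / 2 by lra.
  have [eta eta0 [N N1 hN]] := small _ d2.
  exists (fun t => \int[nu_ t]_(x in S) (phi (synthesis e (crd N x)) + (-1) * err N eta x)).
  exists (\int[nu]_(x in S) (phi (synthesis e (crd N x)) + (-1) * err N eta x)); split.
  - exact: cvgG.
  - rewrite lerBlDr; apply: (@le_trans _ _ (\int[nu]_(x in S)
        ((phi (synthesis e (crd N x)) + (-1) * err N eta x) + err N eta x *+ 2))).
      apply: le_Rintegral => //; [exact: iphi| |].
        rewrite (_ : _ \o _ = (EFin \o
            (fun x => phi (synthesis e (crd N x)) + 1 * err N eta x))).
          exact: iG.
        by apply/funext => x /=; congr EFin; ring.
      by move=> x Sx; have /ler_normlP[? ?] := near_proj N eta x eta0 Sx; lra.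
    rewrite RintegralD//; [|exact: iG|exact: ierr2].
    by rewrite lerD2l err2//; lra.
  - near=> t; have [h1 h2] : (nu_ t setT < +oo)%E /\ nu_ t (~` S) = 0%E by near: t.
    apply: le_Rintegral => //; [exact: iG|exact: iphi|].
    by move=> x Sx; have /ler_normlP[? ?] := near_proj N eta x eta0 Sx; lra.
have [eta eta0 [N N1 hN]] := small _ d2.
exists (fun t => \int[nu_ t]_(x in S) (phi (synthesis e (crd N x)) + 1 * err N eta x)).
exists (\int[nu]_(x in S) (phi (synthesis e (crd N x)) + 1 * err N eta x)); split.
- exact: cvgG.
- apply: (@le_trans _ _ (\int[nu]_(x in S) (phi x + err N eta x *+ 2))).
    apply: le_Rintegral => //; [exact: iG| |].
      apply: (@int_sub _ _ _ (C *+ 2 + (c * eta + c / eta) *+ 2) nu_fin mS) => [|x _].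
        by under eq_fun do rewrite mulr2n; do 2 apply: continuous_addr => //.
      have /andP[? ?] := phi0C x; have ? := err0 N eta x eta0.
      by have ? := errC N eta x eta0; rewrite ger0_norm; lra.
    by move=> x Sx; have /ler_normlP[? ?] := near_proj N eta x eta0 Sx; lra.
  rewrite RintegralD//; [|exact: iphi|exact: ierr2].
  by rewrite lerD2l err2//; lra.
- near=> t; have [h1 h2] : (nu_ t setT < +oo)%E /\ nu_ t (~` S) = 0%E by near: t.
  apply: le_Rintegral => //; [exact: iphi|exact: iG|].
  by move=> x Sx; have /ler_normlP[? ?] := near_proj N eta x eta0 Sx; lra.
Unshelve. all: by end_near. Qed.

End SphereConvergence.

(** * Measures on the punctured space *)

Lemma integrable_indic_lty d (T : measurableType d) (R : realType)
    (mu : {measure set T -> \bar R}) (A D : set T) :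
  measurable D -> measurable A -> (mu A < +oo)%E ->
  mu.-integrable D (EFin \o \1_A).
Proof.
move=> mD mA muA; apply: (integrableS measurableT) => //.
apply/integrableP; split; first exact/measurable_EFinP/measurable_indic.
under eq_integral => x _ do rewrite /= ger0_norm//.
by rewrite integral_indic// setIT.
Qed.

Section Cutoff.
Context (R : realType) (E : normedModType R).
Local Notation pct := (@punctured R E).
Local Notation bpct := (pct : set (borel E)).

Lemma dilateE (t : R) (A : set E) : t != 0 -> dilate t A = [set x | A (t^-1 *: x)].
Proof.
move=> t0; apply/seteqP; split => [_ [x Ax <-]|x Ax] /=.
  by rewrite scalerA mulVf// scale1r.
by exists (t^-1 *: x); rewrite // scalerA divff// scale1r.
Qed.

(** A continuous function between the indicators of |x| > b and |x| > a when a < b; for 0 < a it is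
    an admissible test function. *)
Definition ramp (a b : R) (x : E) : R :=
  Num.max 0 (Num.min 1 ((`|x| - a) / (b - a))).

Lemma ramp01 a b x : 0 <= ramp a b x <= 1.
Proof. by rewrite /ramp le_max lexx/= ge_max ler01 ge_min lexx. Qed.

Lemma ramp_eq0 a b x : a < b -> `|x| <= a -> ramp a b x = 0.
Proof.
move=> ab xa; apply: max_l; rewrite ge_min; apply/orP; right.
by rewrite pmulr_lle0 ?invr_gt0 ?subr_gt0// subr_le0.
Qed.

Lemma ramp_eq1 a b x : a < b -> b <= `|x| -> ramp a b x = 1.
Proof.
move=> ab bx; rewrite /ramp min_l; first by rewrite max_r.
by rewrite ler_pdivlMr ?subr_gt0// mul1r lerB.
Qed.

Lemma ramp_lipschitz a b x y : a < b ->
  `|ramp a b x - ramp a b y| <= (b - a)^-1 * `|x - y|.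
Proof.
move=> ab; have ba : 0 < (b - a)^-1 by rewrite invr_gt0 subr_gt0.
set u := (`|x| - a) / (b - a); set v := (`|y| - a) / (b - a).
apply: (@le_trans _ _ `|u - v|).
  have clip (p q : R) :
      Num.max 0 (Num.min 1 p) <= Num.max 0 (Num.min 1 q) + `|p - q|.
    rewrite ge_max; apply/andP; split; first by rewrite addr_ge0// le_max lexx.
    have pq := ler_norm (p - q); have d0 := normr_ge0 (p - q).
    rewrite ge_min; apply/orP; have [q1|q1] := leP 1 q.
      by left; rewrite max_r// lerDl.
    by right; rewrite -lerBlDr le_max; apply/orP; right; lra.
  rewrite /ramp -/u -/v; apply/ler_normlP; split.
    by have := clip v u; rewrite distrC; lra.
  by have := clip u v; lra.
rewrite /u /v -mulrBl opprB addrA subrK normrM (gtr0_norm ba) mulrC ler_pM2l//.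
exact: ler_dist_dist.
Qed.

Lemma ramp_continuous a b : a < b -> continuous (ramp a b).
Proof.
move=> ab; apply: (@lipschitz_continuous _ _ _ (b - a)^-1) => x y.
exact: ramp_lipschitz.
Qed.

Lemma ramp_C0 a b : 0 < a -> a < b -> C0 (ramp a b).
Proof.
move=> a0 ab; split.
- by apply: continuous_subspaceT; exact: ramp_continuous.
- apply: (@bound_bounded_fun _ _ _ _ 1) => x _.
  by have /andP[? ?] := ramp01 a b x; rewrite ger0_norm.
- rewrite near_withinE; apply/nbhs_ballP; exists a => //= x.
  rewrite -ball_normE/= sub0r normrN => xa _; rewrite ramp_eq0// ltW//.
Qed.

Lemma punctured_open : open (pct : set E).
Proof.
apply: closed_openC.
exact/accessible_closed_set1/hausdorff_accessible/norm_hausdorff.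
Qed.

Lemma punctured_measurable : measurable bpct.
Proof. by apply: borel_open_measurable; exact: punctured_open. Qed.

(** The strict inequality matches [exceeds], so that scaled laws give this set a tail probability of
    the norm, up to the normalization. *)
Definition outside (r : R) : set (borel E) := [set x : E | r < `|x|].

Lemma outside_measurable r : measurable (outside r).
Proof.
apply: borel_open_measurable; rewrite /outside.
have /continuousP := @norm_continuous _ E.
by move=> /(_ [set z | r < z] (@open_gt _ _)).
Qed.

Lemma outside_sub r : 0 <= r -> outside r `<=` pct.
Proof. by move=> r0 x /= rx x0; move: rx; rewrite /outside/= x0 normr0 ltNge r0. Qed.

Lemma C0_bound (f : E -> R) : C0 f -> exists C eps : R,
  [/\ 0 < C, 0 < eps, forall x, pct x -> `|f x| <= C &
      forall x, pct x -> `|x| < eps -> f x = 0].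
Proof.
move=> [_ /bounded_fun_bound[C C0' fC]].
rewrite near_withinE => /nbhs_ballP[eps /= eps0 fe].
exists C, eps; split => // x px xe; apply: fe; last by apply/eqP; exact: px.
by rewrite -ball_normE/= sub0r normrN.
Qed.

Lemma M0_outside (mu : {measure set (borel E) -> \bar R}) r :
  M0 mu -> 0 < r -> (mu (outside r) < +oo)%E.
Proof.
move=> Mmu r0; apply: Mmu; first exact: outside_measurable.
- exact/outside_sub/ltW.
- by exists r => // x /ltW.
Qed.

Lemma outside_integrable (mu : {measure set (borel E) -> \bar R}) (f : E -> R) r C :
  M0 mu -> 0 < r -> measurable_fun bpct (f : borel E -> R) ->
  (forall x, pct x -> `|f x| <= C) ->
  (forall x, pct x -> `|x| <= r -> f x = 0) ->
  mu.-integrable bpct (EFin \o f).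
Proof.
move=> Mmu r0 mf fC f0; have mD := outside_measurable r.
have C0' : 0 <= `|C| by [].
apply: (@integrable_le _ _ _ mu _ f (fun x => `|C| * \1_(outside r) x)) => //.
- exact: punctured_measurable.
- rewrite (_ : _ \o _ = (fun x => `|C|%:E * (\1_(outside r) x)%:E)%E); last first.
    by apply/funext => x; rewrite /= EFinM.
  apply: integrableZl => //; first exact: punctured_measurable.
  apply: integrable_indic_lty => //; first exact: punctured_measurable.
  exact: M0_outside.
- move=> x px; rewrite indicE; have [xr|xr] := leP `|x| r.
    by rewrite f0// normr0 mulr_ge0.
  by rewrite mem_set// mulr1 (le_trans (fC _ px))// ler_norm.
Qed.

Lemma C0_integrable (mu : {measure set (borel E) -> \bar R}) (f : E -> R) :
  M0 mu -> C0 f -> mu.-integrable bpct (EFin \o f).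
Proof.
move=> Mmu Cf; have [C [eps [C0' eps0 fC f0]]] := C0_bound Cf.
have e2 : 0 < eps / 2 by rewrite divr_gt0.
apply: (outside_integrable Mmu e2 _ fC) => [|x px xe].
  apply: borel_within_continuous_measurable; first exact: punctured_measurable.
  by case: Cf.
by apply: f0 => //; apply: (le_lt_trans xe); rewrite ltr_pdivrMr// ltr_pMr// ltr1n.
Qed.

Lemma finite_M0 (mu : {measure set (borel E) -> \bar R}) :
  (mu setT < +oo)%E -> M0 mu.
Proof.
by move=> muT A mA _ _; apply: le_lt_trans muT; apply: le_measure; rewrite ?inE.
Qed.

End Cutoff.
Arguments ramp {R E}.
Arguments outside {R} E.

(** * Tails of homogeneous measures *)

Section TailMeasure.
Context (R : realType) (E : normedModType R).
Local Notation pct := (@punctured R E).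
Local Notation bpct := (pct : set (borel E)).
Local Notation measureE := {measure set (borel E) -> \bar R}.

Definition homogeneous (alpha : R) (mu : measureE) : Prop :=
  forall (t : R) (A : set (borel E)), 0 < t -> measurable A -> A `<=` pct ->
    mu (dilate t A) = ((t `^ (- alpha))%:E * mu A)%E.

(** Real-valued integrals lose nothing here: test functions are integrable for every measure in
    [M0]. *)
Definition M0_Rcvg (mu_ : nat -> measureE) (mu : measureE) : Prop :=
  forall f : E -> R, C0 f ->
    \int[mu_ n]_(x in bpct) f x @[n --> \oo] -->
    \int[mu]_(x in bpct) f x.

Lemma Rintegral_outside (mu : measureE) r : 0 <= r ->
  \int[mu]_(x in bpct) \1_(outside E r) x = fine (mu (outside E r)).
Proof.
move=> r0; rewrite /Rintegral integral_indic//.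
- by rewrite setIidl//; exact: outside_sub.
- exact: punctured_measurable.
- exact: outside_measurable.
Qed.

Lemma outside_integrable_indic (mu : measureE) r : M0 mu -> 0 < r ->
  mu.-integrable bpct (EFin \o \1_(outside E r)).
Proof.
move=> Mmu r0; apply: integrable_indic_lty.
- exact: punctured_measurable.
- exact: outside_measurable.
- exact: M0_outside.
Qed.

Lemma Rintegral_ramp_le (mu : measureE) a b : M0 mu -> 0 < a -> a < b ->
  \int[mu]_(x in bpct) ramp a b x <= fine (mu (outside E a)).
Proof.
move=> Mmu a0 ab; rewrite -(Rintegral_outside mu (ltW a0)); apply: le_Rintegral.
- exact: punctured_measurable.
- by apply: C0_integrable => //; exact: ramp_C0.
- exact: outside_integrable_indic.
- move=> x _; rewrite indicE; have [xa|xa] := leP `|x| a.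
    by rewrite ramp_eq0.
  by rewrite mem_set//; have /andP[] := ramp01 a b x.
Qed.

Lemma Rintegral_ramp_ge (mu : measureE) a b : M0 mu -> 0 < a -> a < b ->
  fine (mu (outside E b)) <= \int[mu]_(x in bpct) ramp a b x.
Proof.
move=> Mmu a0 ab; have b0 : 0 < b by exact: lt_trans ab.
rewrite -(Rintegral_outside mu (ltW b0)); apply: le_Rintegral.
- exact: punctured_measurable.
- exact: outside_integrable_indic.
- by apply: C0_integrable => //; exact: ramp_C0.
- move=> x _; rewrite indicE; have [bx|bx] := ltP b `|x|.
    by rewrite (ramp_eq1 ab (ltW bx)) mem_set//.
  have nx : ~ outside E b x by rewrite /outside/= ltNge bx.
  rewrite memNset//=; by have /andP[] := ramp01 a b x.
Qed.

Lemma dilate_outside (r s : R) : 0 < r -> dilate r (outside E s) = outside E (r * s).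
Proof.
move=> r0; rewrite dilateE ?gt_eqF//; apply/seteqP.
rewrite /outside; split => x /=; rewrite normrZ ger0_norm ?invr_ge0 ?(ltW r0)//.
  by rewrite mulrC ltr_pdivlMr// mulrC.
by move=> h; rewrite mulrC ltr_pdivlMr// mulrC.
Qed.

Lemma homogeneous_outside (mu : measureE) alpha r : M0 mu ->
  homogeneous alpha mu -> 0 < r ->
  fine (mu (outside E r)) = r `^ (- alpha) * fine (mu (outside E 1)).
Proof.
move=> Mmu hom r0; have := hom r (outside E 1) r0 (@outside_measurable R E 1).
move=> /(_ (@outside_sub _ _ _ ler01)); rewrite dilate_outside// mulr1 => ->.
rewrite fineM// ge0_fin_numE//; exact: M0_outside.
Qed.

Lemma powR_continuous_at (p r : R) : 0 < r -> s `^ p @[s --> r] --> r `^ p.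
Proof.
move=> r0; apply: (@cvg_trans _ ((fun s => expR (p * ln s)) @ r)).
  apply: near_eq_cvg; near=> s; rewrite /powR gt_eqF//.
  by near: s; exact: lt_nbhsr.
rewrite /powR gt_eqF//; apply: (@continuous_comp R R R (fun s => p * ln s) expR).
  by apply: cvgM; [exact: cvg_cst|exact: continuous_ln].
exact: continuous_expR.
Unshelve. all: by end_near. Qed.

(** By homogeneity the tail of [mu] is a multiple of r^(-alpha), hence continuous in [r]. Ramps on
    [r, r + d] and [r - d, r] then squeeze the indicator at arbitrarily small cost, as for a
    continuity set in the portmanteau theorem. *)
Lemma outside_cvg (mu_ : nat -> measureE) (mu : measureE) alpha r :
  (forall n, M0 (mu_ n)) -> M0 mu -> homogeneous alpha mu -> M0_Rcvg mu_ mu ->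
  0 < r -> fine (mu_ n (outside E r)) @[n --> \oo] --> fine (mu (outside E r)).
Proof.
move=> Mmu_ Mmu hom cvgmu r0.
have cs : (fun s => s `^ (- alpha) * fine (mu (outside E 1))) @ r -->
    fine (mu (outside E r)).
  rewrite (homogeneous_outside Mmu hom r0).
  by apply: cvgMr_tmp; exact: powR_continuous_at.
have close e : 0 < e -> exists d, [/\ 0 < d, d < r &
    forall s, `|r - s| <= d -> `|fine (mu (outside E r)) - fine (mu (outside E s))| <= e].
  move=> e0; move/cvgrPdist_le : cs => /(_ _ e0)/nbhs_ballP[d /= d0 rd].
  (* Halving forces [s] to be positive and fits a closed condition on [s] into the open ball. *)
  have dr0 : 0 < Num.min d r / 2 by rewrite divr_gt0// lt_min d0.
  have dr1 : Num.min d r / 2 < Num.min d r.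
    by rewrite ltr_pdivrMr// ltr_pMr ?ltr1n// lt_min d0.
  exists (Num.min d r / 2); split => // [|s rs].
    by apply: (lt_le_trans dr1); rewrite ge_min lexx orbT.
  have s0 : 0 < s.
    have : Num.min d r <= r by rewrite ge_min lexx orbT.
    by move/ler_normlP : rs => [_]; lra.
  rewrite (homogeneous_outside Mmu hom s0); apply: rd.
  rewrite -ball_normE/=; apply: (le_lt_trans rs); apply: (lt_le_trans dr1).
  by rewrite ge_min lexx.
apply: cvg_sandwich => e e0; have [d [d0 dr rd]] := close _ e0.
  have rrd : r < r + d by rewrite ltrDl.
  exists (fun n => \int[mu_ n]_(x in bpct) ramp r (r + d) x).
  exists (\int[mu]_(x in bpct) ramp r (r + d) x); split.
  - by apply: cvgmu; exact: ramp_C0.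
  - apply: le_trans (Rintegral_ramp_ge Mmu r0 rrd).
    have /rd/ler_normlP[_] : `|r - (r + d)| <= d.
      by rewrite opprD addrA subrr sub0r normrN ger0_norm// ltW.
    by lra.
  - by near=> n; exact: Rintegral_ramp_le.
have rd0 : 0 < r - d by rewrite subr_gt0.
have rrd : r - d < r by rewrite ltrBlDr ltrDl.
exists (fun n => \int[mu_ n]_(x in bpct) ramp (r - d) r x).
exists (\int[mu]_(x in bpct) ramp (r - d) r x); split.
- by apply: cvgmu; exact: ramp_C0.
- apply: (le_trans (Rintegral_ramp_le Mmu rd0 rrd)).
  have /rd/ler_normlP[h _] : `|r - (r - d)| <= d.
    by rewrite opprB addrC subrK ger0_norm// ltW.
  by lra.
- by near=> n; exact: Rintegral_ramp_ge.
Unshelve. all: by end_near. Qed.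

(** The punctured space is the union of the exteriors of radius 1/(n + 1); homogeneity makes all of
    them null as soon as the one of radius 1 is. *)
Lemma outside_neq0 (mu : measureE) alpha : M0 mu -> homogeneous alpha mu ->
  mu pct <> 0%E -> 0 < fine (mu (outside E 1)).
Proof.
move=> Mmu hom mu0; rewrite lt_neqAle fine_ge0// andbT; apply/eqP => c0; apply: mu0.
have bigE : bpct = \bigcup_n outside E n.+1%:R^-1.
  apply/seteqP; split => [x x0|x [n _]]; last exact: outside_sub.
  have {}x0 : 0 < `|x| by rewrite normr_gt0; apply/eqP; exact: x0.
  exists (Num.truncn `|x|^-1) => //; rewrite /outside/=.
  by rewrite invf_plt ?posrE//; exact: Num.Theory.truncnS_gt.
rewrite bigE; apply/negligibleP.
  by apply: bigcupT_measurable => n; exact: outside_measurable.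
apply: negligible_bigcup => n; apply/negligibleP; first exact: outside_measurable.
have n0 : 0 < n.+1%:R^-1 :> R by rewrite invr_gt0.
have := homogeneous_outside Mmu hom n0; rewrite -c0 mulr0 => h.
by rewrite -[LHS]fineK ?h// ge0_fin_numE//; exact: M0_outside.
Qed.

End TailMeasure.

(** * Scaled laws *)

Lemma eq_measure_Rintegral d (T : measurableType d) (R : realType)
    (m1 m2 : {measure set T -> \bar R}) (D : set T) (f : T -> R) :
  (forall A, measurable A -> A `<=` D -> m1 A = m2 A) ->
  \int[m1]_(x in D) f x = \int[m2]_(x in D) f x.
Proof. by move=> m12; congr fine; exact: eq_measure_integral. Qed.

Section ScaledLaws.
Context (R : realType) (E : normedModType R).
Local Notation pct := (@punctured R E).
Local Notation bpct := (pct : set (borel E)).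
Context d (Omega : measurableType d) (P : probability Omega R) (X : Omega -> E).
Hypothesis mX : random_element X.

Lemma scaled_measurable (t : R) :
  measurable_fun setT ((fun w => t *: X w) : Omega -> borel E).
Proof.
apply: (measurableT_comp (f := ( *:%R t) : borel E -> borel E)); last exact: mX.
by apply: borel_continuous_measurable_map; exact: scaler_continuous.
Qed.

(** [mscale] takes a nonnegative factor. The absolute value changes nothing at positive [n], where
    [b] will be nonnegative, and yields a finite measure at [n = 0] as well. *)
Definition scaled_law (b : R -> R) (n : nat) : {measure set (borel E) -> \bar R} :=
  mscale (`|b n%:R|%:nng) (image_measure P (scaled_measurable n%:R^-1)).

Lemma scaled_lawE b n A :
  scaled_law b n A = (`|b n%:R|%:E * P [set w | A (n%:R^-1 *: X w)])%E.
Proof. by []. Qed.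

Lemma scaled_law_dilate b n : (0 < n)%N -> 0 <= b n%:R ->
  (fun A => (b n%:R)%:E * P (X @^-1` dilate n%:R A))%E = scaled_law b n.
Proof.
move=> n0 bn; apply/funext => A; rewrite scaled_lawE ger0_norm//.
by rewrite dilateE ?pnatr_eq0 -?lt0n.
Qed.

Lemma scaled_law_lty b n : (scaled_law b n setT < +oo)%E.
Proof.
rewrite scaled_lawE (_ : [set _ | _] = setT); last by apply/seteqP.
by rewrite probability_setT mule1 ltry.
Qed.

Lemma scaled_law_M0 b n : M0 (scaled_law b n).
Proof. by apply: finite_M0; exact: scaled_law_lty. Qed.

Lemma exceeds_measurable t : measurable (exceeds X t).
Proof.
rewrite [X in measurable X](_ : _ = X @^-1` outside E t); last by [].
by rewrite -[X in measurable X]setTI; apply: mX => //; exact: outside_measurable.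
Qed.

Lemma scaled_law_outside b n r : (0 < n)%N ->
  scaled_law b n (outside E r) = (`|b n%:R|%:E * P (exceeds X (n%:R * r)))%E.
Proof.
move=> n0; rewrite scaled_lawE; congr (_ * P _)%E.
have n0' : 0 < n%:R^-1 :> R by rewrite invr_gt0 ltr0n.
apply/seteqP; rewrite /exceeds /outside.
by split=> w /=; rewrite normrZ gtr0_norm// ltr_pdivlMl ?ltr0n.
Qed.

(** For positive [n] the set function on the left coincides with [scaled_law b n], which is enough
    in the limit; all the integrals are finite, so extended and real convergence agree. *)
Lemma M0_cvgP b (mu : {measure set (borel E) -> \bar R}) : M0 mu ->
  (forall n : nat, (0 < n)%N -> 0 <= b n%:R) ->
  M0_cvg (fun n A => (b n%:R)%:E * P (X @^-1` dilate n%:R A))%E mu <->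
  M0_Rcvg (scaled_law b) mu.
Proof.
move=> Mmu b0.
have EE (f : E -> R) : C0 f -> \forall n \near \oo,
    (\int[fun A : set (borel E) =>
         ((b n%:R)%:E * P (X @^-1` dilate n%:R A))%E]_(x in bpct) (f x)%:E =
    (\int[scaled_law b n]_(x in bpct) f x)%:E)%E.
  move=> Cf; near=> n; have n0 : (0 < n)%N by near: n; exact: nbhs_infty_gt.
  rewrite (scaled_law_dilate n0 (b0 _ n0)) fineK//.
  apply: integrable_fin_num; first exact: punctured_measurable.
  by apply: C0_integrable => //; exact: scaled_law_M0.
have fmu (f : E -> R) : C0 f -> (\int[mu]_(x in bpct) (f x)%:E =
    (\int[mu]_(x in bpct) f x)%:E)%E.
  move=> Cf; rewrite fineK//; apply: integrable_fin_num.
    exact: punctured_measurable.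
  exact: C0_integrable.
split=> h f Cf.
  have := h f Cf; rewrite fmu// => hf.
  have : (\int[scaled_law b n]_(x in bpct) f x)%:E @[n --> \oo] -->
      (\int[mu]_(x in bpct) f x)%:E.
    by apply: cvg_trans hf; apply: near_eq_cvg; exact: EE.
  by move/fine_cvg; exact.
rewrite fmu//.
have : (\int[scaled_law b n]_(x in bpct) f x)%:E @[n --> \oo] -->
    (\int[mu]_(x in bpct) f x)%:E.
  by apply: cvg_EFin; [near=> n|exact: (h f Cf)].
apply: cvg_trans; apply: near_eq_cvg; apply: filterS (EE f Cf) => n /= ->.
by [].
Unshelve. all: by end_near. Qed.

Lemma regularly_varyingP alpha : regularly_varying P alpha X <->
  exists (mu : {measure set (borel E) -> \bar R}) (b : R -> R) (rho : R),
    [/\ M0 mu /\ mu pct <> 0%E, regularly_varying_fun b rho,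
        forall n : nat, (0 < n)%N -> 0 <= b n%:R,
        M0_Rcvg (scaled_law b) mu & homogeneous alpha mu].
Proof.
split=> -[mu [b [rho [[Mmu mu0] rb b0 cv hom]]]]; exists mu, b, rho; split => //.
  exact/(M0_cvgP Mmu b0).
exact/(M0_cvgP Mmu b0).
Qed.

(** If a tail probability vanished, the scaled laws would give no mass to |x| > 1 from some [n] on,
    and neither would the nonzero limit. This is what makes the conditional laws meaningful. *)
Lemma exceeds_gt0 alpha t : regularly_varying P alpha X -> 0 < t ->
  (0 < P (exceeds X t))%E.
Proof.
move=> /regularly_varyingP[mu [b [rho [[Mmu mu0] _ b0 cv hom]]]] t0.
rewrite lt_neqAle measure_ge0 andbT; apply/eqP => Pt.
have h := outside_cvg (scaled_law_M0 b) Mmu hom cv ltr01.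
have := outside_neq0 Mmu hom mu0; suff -> : fine (mu (outside E 1)) = 0 by rewrite ltxx.
apply/esym/(cvg_unique _ _ h) => //.
apply: (@cvg_trans _ ((fun=> 0 : R) @ \oo)); last exact: cvg_cst.
apply: near_eq_cvg; near=> n.
have nt : t <= n%:R by near: n; exact: nbhs_infty_ger.
have n0 : (0 < n)%N by rewrite -(ltr0n R) (lt_le_trans t0).
rewrite scaled_law_outside// mulr1.
suff -> : P (exceeds X n%:R) = 0%E by rewrite mule0.
apply/eqP; rewrite eq_le measure_ge0 andbT Pt; apply: le_measure.
- by rewrite inE; exact: exceeds_measurable.
- by rewrite inE; exact: exceeds_measurable.
- by move=> w; rewrite /exceeds/=; exact: le_lt_trans.
Unshelve. all: by end_near. Qed.

End ScaledLaws.

(** * Regular variation of the norm *)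

Section NormRegularVariation.
Context (R : realType) (E : normedModType R).
Context d (Omega : measurableType d) (P : probability Omega R) (X : Omega -> E).
Hypothesis mX : random_element X.

Let norm : borel E -> borel R^o := fun x => `|x|.

Let norm_measurable : measurable_fun setT norm.
Proof. by apply: borel_continuous_measurable_map; exact: norm_continuous. Qed.

Lemma random_element_norm : random_element ((fun w => `|X w|) : Omega -> R^o).
Proof. exact: (measurableT_comp norm_measurable mX). Qed.

Let norm_pct : norm @^-1` @punctured R R^o = @punctured R E.
Proof.
apply/seteqP; split=> x /= h x0; apply: h; first by rewrite /= /norm x0 normr0.
by apply/eqP; rewrite -normr_eq0; apply/eqP.
Qed.

Let C0_norm (f : R^o -> R) : C0 f -> C0 (f \o norm).
Proof.
move=> Cf; have [C [eps [C0' eps0 fC f0]]] := C0_bound Cf; split.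
- apply/subspace_continuousP => x px.
  have nx : punctured (norm x : R^o) by rewrite -norm_pct in px.
  have cf : {in @punctured R R^o, continuous f}.
    by rewrite -continuous_open_subspace; [case: Cf|exact: punctured_open].
  apply: cvg_trans; last first.
    apply: (@continuous_comp E R^o R (fun x => `|x|) f x); first exact: norm_continuous.
    by apply: cf; rewrite inE.
  by apply: cvg_fmap2; exact: cvg_within.
- by apply: (@bound_bounded_fun _ _ _ _ C) => x; rewrite -norm_pct => /fC.
- rewrite near_withinE; apply/nbhs_ballP; exists eps => //= x.
  rewrite -ball_normE/= sub0r normrN => xa /eqP x0; apply: f0.
    by have : @punctured R E x by []; rewrite -norm_pct.
  by rewrite /norm normr_id.
Qed.

(** The norm commutes with positive dilations: it carries the scaled laws of [X] to those of its
    norm, with the same [b], and inverse images of dilated sets are dilated inverse images, which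
    transfers homogeneity. *)
Lemma regularly_varying_norm alpha : regularly_varying P alpha X ->
  regularly_varying P alpha (fun w => `|X w| : R^o).
Proof.
move=> /(regularly_varyingP P mX)[mu [b [rho [[Mmu mu0] rb b0 cv hom]]]].
apply/(regularly_varyingP P random_element_norm).
exists (image_measure mu norm_measurable), b, rho.
have mpct := @punctured_measurable R R^o.
have mnorm A : measurable (A : set (borel R^o)) -> measurable (norm @^-1` A).
  by move=> mA; rewrite -[X in measurable X]setTI; exact: norm_measurable.
have M0norm (m : {measure set (borel E) -> \bar R}) :
    M0 m -> M0 (image_measure m norm_measurable).
  move=> Mm A mA Ap [r r0 Ar]; rewrite image_measureE; apply: Mm.
  - exact: mnorm.
  - by move=> x /Ap; rewrite -norm_pct.
  - by exists r => // x /Ar; rewrite normr_id.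
have int_norm (m : {measure set (borel E) -> \bar R}) (f : R^o -> R) : M0 m -> C0 f ->
    \int[image_measure m norm_measurable]_(x in (@punctured R R^o : set (borel R^o))) f x
    = \int[m]_(x in (@punctured R E : set (borel E))) (f \o norm) x.
  move=> Mm Cf; rewrite Rintegral_image//; first by rewrite norm_pct.
    by apply: borel_within_continuous_measurable => //; case: Cf.
  by rewrite norm_pct; apply: C0_integrable => //; exact: C0_norm.
split => //.
- split; first exact: M0norm.
  by rewrite image_measureE norm_pct.
- move=> f Cf; rewrite int_norm//; apply: cvg_trans (cv _ (C0_norm Cf)).
  apply: near_eq_cvg; apply: nearW => n.
  rewrite -(int_norm _ _ (scaled_law_M0 P mX b n) Cf).
  apply: eq_measure_Rintegral => A mA _.
  rewrite image_measureE !scaled_lawE; congr (_ * P _)%E.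
  by apply/seteqP; split=> w /=; rewrite /norm normrZ ger0_norm ?invr_ge0.
- move=> t A t0 mA Ap; rewrite image_measureE.
  rewrite (_ : norm @^-1` dilate t A = dilate t (norm @^-1` A)); last first.
    rewrite !dilateE ?gt_eqF//; apply/seteqP.
    by split=> x /=; rewrite /norm normrZ ger0_norm ?invr_ge0 ?ltW.
  by rewrite hom//; [exact: mnorm|move=> x /Ap; rewrite -norm_pct].
Qed.

End NormRegularVariation.

(** * Polar decomposition *)

Lemma ge0_Rintegral_mscale d (T : measurableType d) (R : realType)
    (mu : {measure set T -> \bar R}) (k : {nonneg R}) (D : set T) (f : T -> R) :
  measurable D -> mu.-integrable D (EFin \o f) -> (forall x, D x -> 0 <= f x) ->
  \int[mscale k mu]_(x in D) f x = k%:num * \int[mu]_(x in D) f x.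
Proof.
move=> mD intf f0; rewrite /Rintegral ge0_integral_mscale//.
- by rewrite fineM//; exact: integrable_fin_num.
- by case/integrableP : intf.
Qed.

Section PolarMeasure.
Context (R : realType) (H : normedModType R).
Local Notation pct := (@punctured R H).
Local Notation bpct := (pct : set (borel H)).
Local Notation S := (unit_sphere H : set (borel H)).
Local Notation measureH := {measure set (borel H) -> \bar R}.

Definition angle (x : borel H) : borel H := `|x|^-1 *: x.

(** Continuity is used on the open punctured space only. The remaining part of an inverse image is
    [[set 0]] or empty, according to whether [U] contains [angle 0], which is 0 by the convention on
    inverses. *)
Lemma angle_measurable : measurable_fun setT angle.
Proof.
have mp := @punctured_measurable R H.
apply: (@measurability _ _ (borel H) (borel H) _ _ (@open H) erefl).
move=> _ [U oU <-]; rewrite setTI.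
have -> : angle @^-1` U = (pct `&` angle @^-1` U) `|` (~` pct `&` angle @^-1` U).
  by rewrite -setIUl setUv setTI.
apply: measurableU.
  apply: borel_open_measurable; rewrite openE => x [px Ux].
  have nx : `|x| != 0 by rewrite normr_eq0; apply/eqP.
  have ca : {for x, continuous (fun y : H => `|y|^-1 *: y)}.
    apply: cvgZ; last exact: cvg_id.
    by apply: cvgV => //; exact: norm_continuous.
  apply: filterI.
    exact: (open_nbhs_nbhs (conj (@punctured_open R H) px)).
  by apply: ca; exact: open_nbhs_nbhs.
have [U0|U0] := pselect (U 0).
  rewrite (_ : _ `&` _ = ~` pct); first exact: measurableC.
  apply/seteqP; split=> [x []//|x /= px]; split => //.
  by move/contrapT : px => /= ->; rewrite /angle /= scaler0.
rewrite (_ : _ `&` _ = set0); first exact: measurable0.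
apply/seteqP; split=> // x [/= /contrapT -> /=].
by rewrite /angle scaler0.
Qed.

Lemma angle_sphere : angle @^-1` S = pct.
Proof.
apply/seteqP; split=> x /=; rewrite /unit_sphere/= /angle normrZ.
  by move=> h x0; move: h; rewrite x0 normr0 mulr0 => /esym/eqP; rewrite oner_eq0.
move=> px; have nx : `|x| != 0 by rewrite normr_eq0; apply/eqP.
by rewrite ger0_norm ?invr_ge0// mulVf.
Qed.

Lemma angleK x : `|x| *: angle x = x.
Proof.
have [->|x0] := eqVneq x (0 : H); first by rewrite normr0 scale0r.
by rewrite /angle scalerA divff ?scale1r// normr_eq0.
Qed.

Lemma angleZ (t : R) x : 0 < t -> angle (t *: x) = angle x.
Proof.
move=> t0; rewrite /angle normrZ gtr0_norm// invfM scalerA.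
by rewrite mulrAC mulVf ?mul1r// gt_eqF.
Qed.

(** The total mass is [mu (outside H r)]; dividing by it gives the conditional law of the angle
    above level [r]. *)
Definition polar (mu : measureH) (r : R) : measureH :=
  image_measure (mrestr mu (outside_measurable r)) angle_measurable.

Lemma polarE mu r A : polar mu r A = mu (angle @^-1` A `&` outside H r).
Proof. by []. Qed.

Lemma Rintegral_polar (mu : measureH) (g : H -> R) r C : 0 <= r ->
  (mu (outside H r) < +oo)%E -> continuous g -> (forall x, S x -> `|g x| <= C) ->
  \int[mu]_(x in bpct) ((g \o angle) \_ (outside H r)) x =
  \int[polar mu r]_(x in S) g x.
Proof.
move=> r0 mur cg gC; have mS := @unit_sphere_measurable R H.
have mp := @punctured_measurable R H; have mo := @outside_measurable R H r.
have ma := angle_measurable.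
have mg : measurable_fun setT (g : borel H -> R) by exact: borel_continuous_measurable.
have mga : measurable_fun setT (g \o angle) by exact: measurableT_comp.
have gaC x : pct x -> `|g (angle x)| <= C.
  by rewrite -angle_sphere => /gC.
have restr_fin : (mrestr mu mo setT < +oo)%E by rewrite /mrestr setTI.
have iga : (mrestr mu mo).-integrable bpct (EFin \o (g \o angle)).
  apply: measurable_bounded_integrable => //.
  - by apply: le_lt_trans restr_fin; apply: le_measure; rewrite ?inE.
  - exact: measurable_funTS.
  - exact: bound_bounded_fun gaC.
rewrite /polar Rintegral_image//; last 2 first.
- exact: measurable_funTS.
- by rewrite angle_sphere.
rewrite angle_sphere; transitivity (\int[mrestr mu mo]_(x in outside H r) (g \o angle) x).
  rewrite (@eq_measure_Rintegral _ _ _ (mrestr mu mo) mu); last first.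
    by move=> A mA Ar; rewrite /= /mrestr setIidl.
  by rewrite -Rintegral_mkcondr setIidr//; exact: outside_sub.
apply/esym/Rintegral_carried => //; first exact: outside_sub.
by rewrite /= /mrestr setICl measure0.
Qed.

End PolarMeasure.
Arguments angle {R H}.

(** * From angular integrals to convergence on the punctured space *)

Section Staircase.
Context (R : realType) (H : normedModType R).
Local Notation pct := (@punctured R H).
Local Notation bpct := (pct : set (borel H)).
Local Notation S := (unit_sphere H : set (borel H)).
Local Notation measureH := {measure set (borel H) -> \bar R}.
Context (mu_ : nat -> measureH) (mu : measureH).
Hypotheses (M0mu_ : forall n, M0 (mu_ n)) (M0mu : M0 mu).
Hypothesis polar_cvg : forall (g : H -> R) (r C : R), 0 < r -> continuous g ->
  (forall x, 0 <= g x <= C) ->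
  \int[polar (mu_ n) r]_(x in S) g x @[n --> \oo] --> \int[polar mu r]_(x in S) g x.
Hypothesis tight : forall r e : R, 0 < e ->
  exists2 M, r < M & fine (mu (outside H M)) <= e.
Hypothesis pct0 : pct !=set0.

(** The functions for which convergence is already settled: a vector space containing the functions
    of the angle cut off at a positive radius. *)
Let good (f : H -> R) := [/\ forall n, (mu_ n).-integrable bpct (EFin \o f),
  mu.-integrable bpct (EFin \o f) &
  \int[mu_ n]_(x in bpct) f x @[n --> \oo] -->
  \int[mu]_(x in bpct) f x].

Let mpct : measurable bpct := @punctured_measurable R H.

Let goodD f g : good f -> good g -> good (fun x => f x + g x).
Proof.
move=> [f1 f2 f3] [g1 g2 g3].
have iD (m : measureH) : m.-integrable bpct (EFin \o f) ->
    m.-integrable bpct (EFin \o g) ->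
    m.-integrable bpct (EFin \o (fun x => f x + g x)).
  by move=> h1 h2; exact: (integrableD mpct h1 h2).
split; [by move=> n; exact: iD|exact: iD|].
rewrite RintegralD//; under eq_fun do rewrite RintegralD//.
exact: (@cvgD _ R^o).
Qed.

Let goodZ c f : good f -> good (fun x => c * f x).
Proof.
move=> [f1 f2 f3].
have iZ (m : measureH) : m.-integrable bpct (EFin \o f) ->
    m.-integrable bpct (EFin \o (fun x => c * f x)).
  by move=> h1; exact: (integrableZl mpct c h1).
split; [by move=> n; exact: iZ|exact: iZ|].
rewrite RintegralZl//; under eq_fun do rewrite RintegralZl//.
by apply: cvgM => //; exact: cvg_cst.
Qed.

Let good_step (g : H -> R) (r C : R) : 0 < r -> continuous g ->
  (forall x, 0 <= g x <= C) -> good ((g \o angle) \_ (outside H r)).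
Proof.
move=> r0 cg gC.
have mo := @outside_measurable R H r.
have gC' x : `|g x| <= C by have /andP[? ?] := gC x; rewrite ger0_norm.
have ma : measurable_fun bpct ((g \o angle) \_ (outside H r)).
  apply: measurable_funTS; apply/(measurable_restrictT _ mo).
  apply: measurable_funTS; apply: measurableT_comp; last exact: angle_measurable.
  exact: borel_continuous_measurable.
have ig (m : measureH) : M0 m ->
    m.-integrable bpct (EFin \o ((g \o angle) \_ (outside H r))).
  move=> Mm; apply: (outside_integrable (C := C) Mm r0 ma) => x _.
    rewrite patchE; case: ifPn => _ /=; rewrite ?normr0 ?gC'//.
    by have := gC x => /andP[]; exact: le_trans.
  by move=> xr; rewrite patchE memNset// /outside/= ltNge xr.
split; [by move=> n; exact: ig|exact: ig|].
rewrite (@Rintegral_polar _ _ mu g r C (ltW r0))//; last exact: M0_outside.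
have E n := @Rintegral_polar _ _ (mu_ n) g r C (ltW r0)
  (M0_outside (M0mu_ n) r0) cg (fun x _ => gC' x).
by under eq_fun do rewrite E; exact: (polar_cvg r0 cg gC).
Qed.

(* [f] is approximated by a radial staircase [Stair], constant along rays on
   each shell [r_i < |x| <= r_(i+1)]. *)
Lemma polar_M0_Rcvg : M0_Rcvg mu_ mu.
Proof.
move=> f Cf; have [C [eps [C0' eps0 fC f0]]] := C0_bound Cf.
(* [f] vanishes for |x| < eps, so a multiple of the ramp from [rho] to [eps] dominates it. A
   nonnegative function below [2 chi] vanishes up to [rho], which is where the staircase starts. *)
pose rho := eps / 2; have rho0 : 0 < rho by rewrite divr_gt0.
have rhoe : rho < eps by rewrite ltr_pdivrMr// ltr_pMr// ltr1n.
pose chi (x : H) : R := C * ramp rho eps x.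
have chi_lip (x y : H) : `|chi x - chi y| <= C * (eps - rho)^-1 * `|x - y|.
  rewrite /chi -mulrBr normrM gtr0_norm// -mulrA ler_pM2l//.
  exact: ramp_lipschitz.
have chi0C (x : H) : 0 <= chi x <= C.
  have /andP[? ?] := ramp01 rho eps x; apply/andP; split.
    by rewrite mulr_ge0// ltW.
  by rewrite ler_piMr// ltW.
have chi_int (m : measureH) : M0 m -> m.-integrable bpct (EFin \o chi).
  move=> Mm; apply: (outside_integrable (C := C) Mm rho0).
  - apply: measurable_funTS; apply: borel_continuous_measurable.
    exact: lipschitz_continuous chi_lip.
  - by move=> x _; have /andP[? ?] := chi0C x; rewrite ger0_norm.
  - by move=> x _ xr; rewrite /chi ramp_eq0// mulr0.
apply: (@cvg_Rintegral_lipschitz R H pct nat \oo mu_ mu chi f C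
  (C * (eps - rho)^-1)) => //.
- by apply: nearW => n; exact: chi_int.
- exact: chi_int.
- move=> phi c' phic' phi0C phichi; pose c := `|c'| + 1.
  have c0 : 0 < c by rewrite /c ltr_wpDl.
  have phic (x y : H) : `|phi x - phi y| <= c * `|x - y|.
    apply: (le_trans (phic' x y)); rewrite ler_wpM2r// (le_trans (ler_norm _))//.
    by rewrite lerDl.
  have cphi : continuous phi := lipschitz_continuous phic.
  have phi0 x : pct x -> `|x| <= rho -> phi x = 0.
    move=> px xr; have := phichi x px; rewrite /chi ramp_eq0// mulr0 mul0rn => h.
    by have /andP[? _] := phi0C x; apply/eqP; rewrite eq_le h.
  have cphiZ (s : R) : continuous (fun x => phi (s *: x)).
    move=> x; apply: (@continuous_comp H H R); first exact: scaler_continuous.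
    exact: cphi.
  pose T (r s : R) := ((fun x => phi (s *: x)) \o angle) \_ (outside H r).
  have goodT r s : 0 < r -> good (T r s).
    by move=> r0; apply: (good_step (C := C *+ 2)).
  have TE r s (x : H) : r < `|x| -> T r s x = phi (s *: angle x).
    by move=> rx; rewrite /T patchT// inE.
  have T0 r s (x : H) : `|x| <= r -> T r s x = 0.
    by move=> xr; rewrite /T patchE memNset// /outside/= ltNge xr.
  have goodO r : 0 < r -> good (fun x => \1_(outside H r) x).
    move=> r0; rewrite (_ : (fun _ => _) = ((cst 1 : H -> R) \o angle) \_ (outside H r)).
      apply: (good_step (C := 1)) => //; first exact: cst_continuous.
      by move=> x; rewrite ler01 lexx.
    by apply/funext => x; rewrite indicE patchE; case: (x \in _).
  pose node delta i : R := rho + i%:R * delta.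
  (* A telescoping sum: crossing node [i + 1] replaces the value of [phi] at radius [node i] by its
     value at radius [node (i + 1)] on the same ray. The starting value, at radius [rho], is 0. *)
  pose stair delta K (x : H) := \sum_(i < K)
    (T (node delta i.+1) (node delta i.+1) x +
     (-1) * T (node delta i.+1) (node delta i) x).
  have node_gt0 delta i : 0 < delta -> 0 < node delta i.
    by move=> d0; rewrite /node ltr_wpDr// mulr_ge0// ltW.
  have good_stair delta K : 0 < delta -> good (stair delta K).
    move=> d0; elim: K => [|K IH].
      rewrite (_ : stair _ _ = (fun x => 0 * \1_(outside H 1) x)).
        exact/goodZ/goodO.
      by apply/funext => x; rewrite /stair big_ord0 mul0r.
    rewrite (_ : stair _ _ = (fun x => stair delta K x +
        (T (node delta K.+1) (node delta K.+1) x +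
        (-1) * T (node delta K.+1) (node delta K) x))).
      apply: goodD => //; apply: goodD; first exact/goodT/node_gt0.
      exact/goodZ/goodT/node_gt0.
    by apply/funext => x; rewrite /stair big_ord_recr.
  (* Both halves are carried by one induction: past the last node the staircase equals [phi] at that
     node, so on the next shell it is off by at most [c * delta]. *)
  have stairP delta K (x : H) : 0 < delta -> pct x ->
      (node delta K < `|x| -> stair delta K x = phi (node delta K *: angle x)) /\
      (`|x| <= node delta K ->
        `|stair delta K x - phi x| <= c * delta * \1_(outside H rho) x).
    move=> d0 px.
    have nx : 0 < `|x| by rewrite normr_gt0; apply/eqP.
    have na : `|angle x| = 1 by move: px; rewrite -angle_sphere.
    elim: K => [|K [IH1 IH2]].
      rewrite /stair big_ord0 /node mul0r addr0; split=> [xr|xr].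
        have nr : `|rho *: angle x| = rho by rewrite normrZ na mulr1 gtr0_norm.
        rewrite phi0//; last by rewrite nr.
        by move=> /= r0; move: nr; rewrite r0 normr0 => /eqP; rewrite lt_eqF.
      by rewrite phi0// subrr normr0 !mulr_ge0// ltW.
    have nodeS : node delta K.+1 = node delta K + delta.
      by rewrite /node -natr1 mulrDl mul1r addrA.
    have stairS : stair delta K.+1 x = stair delta K x +
        (T (node delta K.+1) (node delta K.+1) x +
        (-1) * T (node delta K.+1) (node delta K) x).
      by rewrite /stair big_ord_recr.
    split=> xK; rewrite stairS.
      rewrite !TE// IH1; last by apply: lt_trans xK; rewrite nodeS ltrDl.
      by rewrite mulN1r addrCA subrr addr0.
    rewrite !T0// mulr0 !addr0; have [|Kx] := leP `|x| (node delta K); first exact: IH2.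
    rewrite IH1// -[in phi x](angleK x); apply: (le_trans (phic _ _)).
    rewrite -scalerBl normrZ na mulr1 indicE mem_set ?mulr1; last first.
      by apply: le_lt_trans Kx; rewrite /node lerDl mulr_ge0// ltW.
    have Kx' : 0 <= `|x| - node delta K by lra.
    by rewrite ler_pM2l// distrC ger0_norm//; move: xK; rewrite nodeS; lra.
  (* Past the last node both functions merely lie in [0, 2 C], and tightness takes over. *)
  pose err delta M (x : H) := c * delta * \1_(outside H rho) x +
    C *+ 2 * \1_(outside H M) x.
  have stair_err delta K (x : H) : 0 < delta -> pct x ->
      `|phi x - stair delta K x| <= err delta (node delta K) x.
    move=> d0 px; have [h1 h2] := stairP delta K x d0 px; rewrite /err.
    have i0 : 0 <= c * delta * \1_(outside H rho) x.
      by rewrite mulr_ge0// ?mulr_ge0// ?ltW// indicE.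
    have [xK|xK] := leP `|x| (node delta K).
      rewrite distrC (le_trans (h2 xK))// lerDl mulr_ge0// ?indicE//.
      by rewrite mulrn_wge0// ltW.
    rewrite h1// [\1_(outside H (node _ _)) x]indicE mem_set// mulr1.
    have /andP[a1 a2] := phi0C x; have /andP[b1 b2] := phi0C (node delta K *: angle x).
    by apply/ler_normlP; split; lra.
  have good_err delta M : 0 < M -> good (err delta M).
    by move=> M0'; apply: goodD; exact/goodZ/goodO.
  have good_phi : forall m : measureH, M0 m ->
      m.-integrable bpct (EFin \o phi).
    move=> m Mm; apply: (outside_integrable (C := C *+ 2) Mm rho0) => //.
    - by apply: measurable_funTS; exact: borel_continuous_measurable.
    - by move=> x _; have /andP[? ?] := phi0C x; rewrite ger0_norm.
  have int_err delta M : 0 < M -> \int[mu]_(x in bpct) err delta M x =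
      c * delta * fine (mu (outside H rho)) + C *+ 2 * fine (mu (outside H M)).
    move=> M0'; have [_ io1 _] := goodO _ rho0; have [_ io2 _] := goodO _ M0'.
    have [_ iz1 _] := goodZ (c * delta) (goodO _ rho0).
    have [_ iz2 _] := goodZ (C *+ 2) (goodO _ M0').
    rewrite RintegralD// !RintegralZl// !Rintegral_outside// ltW//.
  have small e : 0 < e -> exists delta K, [/\ 0 < delta, 0 < node delta K &
      \int[mu]_(x in bpct) err delta (node delta K) x <= e].
    move=> e0; have C2 : 0 < C *+ 2 by rewrite mulrn_wgt0.
    have eC : 0 < e / 2 / (C *+ 2) by rewrite !divr_gt0.
    (* Tightness fixes the outer radius. The mesh [(M - rho) / K] makes [M] the last node, and [K]
       is large enough for the error on the shells to stay below [e / 2]. *)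
    have [M rM hM] := tight rho eC.
    set A := fine (mu (outside H rho)); have A0 : 0 <= A by exact: fine_ge0.
    have Mr : 0 < M - rho by rewrite subr_gt0.
    pose K := (Num.truncn (c * (M - rho) * A / (e / 2))).+1.
    have K0 : 0 < K%:R :> R by rewrite ltr0n.
    exists ((M - rho) / K%:R), K.
    have nodeM : node ((M - rho) / K%:R) K = M.
      by rewrite /node mulrC divfK ?gt_eqF// addrC subrK.
    rewrite nodeM; split; [by rewrite divr_gt0|exact: lt_trans rM|].
    rewrite int_err; last exact: lt_trans rM.
    rewrite -/A (splitr e); apply: lerD.
      rewrite mulrA mulrAC ler_pdivrMr// [_ / 2 * _]mulrC -ler_pdivrMr ?divr_gt0//.
      by apply: ltW; exact: Num.Theory.truncnS_gt.
    by rewrite mulrC -ler_pdivlMr.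
  have good_apx s delta K : 0 < delta ->
      good (fun x => stair delta K x + s * err delta (node delta K) x).
    move=> d0; apply: goodD; first exact: good_stair.
    by apply/goodZ/good_err/node_gt0.
  have split_int s delta K : 0 < delta ->
      \int[mu]_(x in bpct) (stair delta K x + s * err delta (node delta K) x) =
      \int[mu]_(x in bpct) stair delta K x +
      s * \int[mu]_(x in bpct) err delta (node delta K) x.
    move=> d0; have [_ i1 _] := good_stair delta K d0.
    have [_ i2 _] := good_err delta _ (node_gt0 delta K d0).
    have [_ i3 _] := goodZ s (good_err delta _ (node_gt0 delta K d0)).
    by rewrite RintegralD// RintegralZl.
  have lo delta K : 0 < delta -> forall m : measureH, M0 m ->
      m.-integrable bpct
        (EFin \o (fun x => stair delta K x + (-1) * err delta (node delta K) x)) ->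
      \int[m]_(x in bpct) (stair delta K x + (-1) * err delta (node delta K) x) <=
      \int[m]_(x in bpct) phi x.
    move=> d0 m Mm im; apply: le_Rintegral => //; first exact: good_phi.
    by move=> x px; have /ler_normlP[? ?] := stair_err delta K x d0 px; lra.
  have hi delta K : 0 < delta -> forall m : measureH, M0 m ->
      m.-integrable bpct
        (EFin \o (fun x => stair delta K x + 1 * err delta (node delta K) x)) ->
      \int[m]_(x in bpct) phi x <=
      \int[m]_(x in bpct) (stair delta K x + 1 * err delta (node delta K) x).
    move=> d0 m Mm im; apply: le_Rintegral => //; first exact: good_phi.
    by move=> x px; have /ler_normlP[? ?] := stair_err delta K x d0 px; lra.
  apply: cvg_sandwich => e e0; have e2 : 0 < e / 2 by rewrite divr_gt0.
    have [delta [K [d0 _ hK]]] := small _ e2.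
    have [g1 g2 g3] := good_apx (-1) delta K d0.
    have [_ h2 _] := good_apx 1 delta K d0.
    exists (fun n => \int[mu_ n]_(x in bpct)
      (stair delta K x + (-1) * err delta (node delta K) x)).
    exists (\int[mu]_(x in bpct)
      (stair delta K x + (-1) * err delta (node delta K) x)).
    split => //; last by apply: nearW => n; exact: lo.
    by have := hi delta K d0 mu M0mu h2; rewrite !split_int//; lra.
  have [delta [K [d0 _ hK]]] := small _ e2.
  have [g1 g2 g3] := good_apx 1 delta K d0.
  have [_ h2 _] := good_apx (-1) delta K d0.
  exists (fun n => \int[mu_ n]_(x in bpct)
    (stair delta K x + 1 * err delta (node delta K) x)).
  exists (\int[mu]_(x in bpct)
    (stair delta K x + 1 * err delta (node delta K) x)).
  split => //; last by apply: nearW => n; exact: hi.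
  by have := lo delta K d0 mu M0mu h2; rewrite !split_int//; lra.
- by case: Cf.
- move=> x px; have [xe|xe] := ltP `|x| eps.
    by rewrite f0// normr0; have /andP[] := chi0C x.
  by rewrite /chi ramp_eq1// mulr1 fC.
Qed.

End Staircase.

(** * The radial limit measure *)

Lemma separable_enum (R : realType) (H : normedModType R) : separable H ->
  exists u : nat -> H, forall (x : H) e, 0 < e -> exists n, `|x - u n| < e.
Proof.
move=> [D /countable_injP[f finj] dD].
(* Numbers not attained on [D] yield the default 0, which does no harm: every point of [D] is still
   listed. *)
pose u n := xget (0 : H) [set d | D d /\ f d = n].
exists u => x e e0; have ob : open (ball x e) by exact: ball_open.
have [|d [xd Dd]] := dD (ball x e) _ ob.
  by exists x; exact: ballxx.
exists (f d); suff -> : u (f d) = d by move: xd; rewrite -ball_normE.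
have [Du fu] : D (u (f d)) /\ f (u (f d)) = f d.
  by apply: (@xgetPex _ (0 : H) [set d' | D d' /\ f d' = f d]); exists d.
by apply: finj; rewrite ?inE.
Qed.

(* Open sets of [H * R] are countable unions of rectangles, so that scaling is
   measurable for the product sigma-algebra. *)
Lemma scale_measurable (R : realType) (H : normedModType R) : separable H ->
  measurable_fun setT ((fun p => p.2 *: p.1) : borel H * borel R^o -> borel H).
Proof.
move=> /separable_enum[u uD].
apply: (@measurability _ _ (borel H * borel R^o)%type (borel H) _ _ (@open H) erefl).
move=> _ [U oU <-]; rewrite setTI.
pose rect (i : nat * rat * nat) : set (borel H * borel R^o) :=
  [set x : H | `|u i.1.1 - x| < i.2.+1%:R^-1] `*`
  [set s : R^o | `|ratr i.1.2 - s| < i.2.+1%:R^-1].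
pose s : borel H * borel R^o -> borel H := fun p => p.2 *: p.1.
pose good i := rect i `<=` s @^-1` U.
have mrect i : measurable (rect i).
  apply: measurableX; apply: borel_open_measurable.
    have : open (ball (u i.1.1) i.2.+1%:R^-1) by apply: ball_open; rewrite invr_gt0.
    by rewrite -ball_normE.
  have : open (ball (ratr i.1.2 : R^o) i.2.+1%:R^-1) by apply: ball_open; rewrite invr_gt0.
  by rewrite -ball_normE.
pose cover i := if pselect (good i) then rect i else set0.
have -> : s @^-1` U = \bigcup_i cover i.
  apply/seteqP; split=> [[x r0]|p [i _]]; last first.
    by rewrite /cover; case: pselect => // gi; exact: gi.
  suff H1 : forall r : R, U (r *: x) -> (\bigcup_i cover i) (x, r) by exact: H1.
  move=> r Ux {r0}.
  have cs : {for ((x, r) : H * R^o), continuous (fun p : H * R^o => p.2 *: p.1)}.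
    by apply: cvgZ; [exact: cvg_snd|exact: cvg_fst].
  have /cs : nbhs (r *: x) U by exact: open_nbhs_nbhs.
  rewrite /= => -[[A B] /= [/nbhs_ballP[d1 /= d10 d1A] /nbhs_ballP[d2 /= d20 d2B]] AB].
  pose d := Num.min d1 d2; have d0 : 0 < d by rewrite lt_min d10.
  (* With radius below [d / 2], a rectangle whose centre is that close to [(x, r)] stays within [d]
     of it in both factors. *)
  pose k := Num.truncn (d / 2)^-1.
  have k0 : 0 < k.+1%:R^-1 :> R by rewrite invr_gt0.
  have kd : k.+1%:R^-1 < d / 2.
    by rewrite invf_plt ?posrE ?divr_gt0//; exact: Num.Theory.truncnS_gt.
  have [eta [etaE eta0 etad]] : exists eta : R,
    [/\ eta = k.+1%:R^-1, 0 < eta & eta < d / 2] by exists k.+1%:R^-1.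
  have [n xn] := uD x _ eta0.
  have [q /andP[rq1 rq2]] : exists q : rat, r - eta < ratr q < r + eta.
    have rr : r - eta < r + eta by lra.
    by have [q hq] := @rat_in_itvoo R _ _ rr; exists q; move: hq; rewrite in_itv.
  exists (n, q, k) => //; rewrite /cover; case: pselect => [gi|ng].
    split => /=; rewrite -etaE; first by rewrite distrC.
    by apply/ltr_normlP; split; lra.
  exfalso; apply: ng => -[y t0] [/=]; rewrite -etaE => yn.
  move: t0 => t tq; have {}tq : `|(ratr q : R) - t| < eta by [].
  have Ut : U ((t : R) *: y).
    apply: (AB (y, t)); split => /=.
      apply: d1A; rewrite -ball_normE/=.
      have : `|x - y| <= `|x - u n| + `|u n - y| by exact: ler_distD.
      have : d <= d1 by rewrite ge_min lexx.
      by lra.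
    apply: d2B; rewrite -ball_normE/=.
    have : d <= d2 by rewrite ge_min lexx orbT.
    have : `|r - (t : R)| <= `|r - ratr q| + `|(ratr q : R) - t| by exact: ler_distD.
    have : `|r - ratr q| < eta by apply/ltr_normlP; split; lra.
    by rewrite /=; move: tq; set a := `|_ - _|; set b := `|_ - _|; set c := `|_ - _|; lra.
  exact: Ut.
apply: countable_bigcupT_measurable => [|i]; first exact: countableP.
by rewrite /cover; case: pselect => gi; [exact: mrect|exact: measurable0].
Qed.

Section RadialMeasure.
Context (R : realType) (H : normedModType R).
Hypothesis sepH : separable H.
Local Notation S := (unit_sphere H : set (borel H)).
Context (Pinf : probability (borel H) R) (PinfS : Pinf S = 1%E).
Context (nu : {measure set (borel R^o) -> \bar R}) (alpha : R).
Hypotheses (M0nu : M0 nu) (nu0 : nu (@punctured R R^o) <> 0%E)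
  (hom_nu : homogeneous alpha nu).

Let nrm : borel R^o -> borel R^o := fun x => `|x|.

Let nrm_measurable : measurable_fun setT nrm.
Proof. by apply: borel_continuous_measurable_map; exact: (@norm_continuous _ R^o). Qed.

(** [nu] may charge both half-lines, and its mass at 0 is arbitrary, possibly infinite. Folding the
    line by the absolute value and discarding 0 gives a sigma-finite measure on the positive
    half-line, fit to be a factor of a product measure. *)
Let rad : {measure set (borel R^o) -> \bar R} :=
  mrestr (image_measure nu nrm_measurable) (@punctured_measurable R R^o).

Let radE A : rad A = nu [set y | A (nrm y) /\ nrm y <> 0].
Proof. by []. Qed.

Let rad_outside r : 0 <= r -> rad (outside R^o r) = nu (outside R^o r).
Proof.
move=> r0; rewrite radE; congr (nu _).
apply/seteqP; rewrite /outside /nrm; split=> y /=; rewrite normr_id; first by case.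
by move=> ry; split=> // y0; move: ry; rewrite y0 ltNge r0.
Qed.

Let rad_sigma_finite : sigma_finite setT rad.
Proof.
(* 0 is added to every set so that together they cover the line; [rad] gives it no mass. *)
exists (fun k => outside R^o k.+1%:R^-1 `|` ~` @punctured R R^o) => [|k].
  apply/seteqP; split=> // x _.
  have [x0|x0] := pselect (@punctured R R^o x); last by exists 0%N => //; right.
  have {}x0 : 0 < `|x| by rewrite normr_gt0; apply/eqP; exact: x0.
  exists (Num.truncn `|x|^-1) => //; left; rewrite /outside/=.
  by rewrite invf_plt ?posrE//; exact: Num.Theory.truncnS_gt.
have mo := @outside_measurable R R^o k.+1%:R^-1.
have mp := measurableC (@punctured_measurable R R^o).
have k0 : 0 < k.+1%:R^-1 :> R by rewrite invr_gt0.
split; first exact: measurableU.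
apply: (@le_lt_trans _ _ (rad (outside R^o k.+1%:R^-1))).
  rewrite !radE; apply: le_measure.
  - rewrite inE (_ : [set _ | _] = nrm @^-1`
      ((outside R^o k.+1%:R^-1 `|` ~` @punctured R R^o) `&` @punctured R R^o)); last by [].
    rewrite -[X in measurable X]setTI; apply: nrm_measurable => //.
    by apply: measurableI; [exact: measurableU|exact: punctured_measurable].
  - rewrite inE (_ : [set _ | _] = nrm @^-1`
      (outside R^o k.+1%:R^-1 `&` @punctured R R^o)); last by [].
    rewrite -[X in measurable X]setTI; apply: nrm_measurable => //.
    by apply: measurableI => //; exact: punctured_measurable.
  - by move=> y [[//|/= /contrapT]] /= h h'; exfalso; exact: h'.
by rewrite rad_outside ?ltW//; exact: M0_outside.
Qed.

Let radsf : {sigma_finite_measure set (borel R^o) -> \bar R} :=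
  HB.pack (rad : set (borel R^o) -> \bar R) (Measure.class rad)
    (Measure_isSigmaFinite.Build _ _ _ rad rad_sigma_finite).

Let sc : borel H * borel R^o -> borel H := fun p => p.2 *: p.1.

Let sc_measurable : measurable_fun setT sc := scale_measurable sepH.

Let mu : {measure set (borel H) -> \bar R} :=
  image_measure (Pinf \x radsf)%E sc_measurable.

Let sec (A : set (borel H)) (th : borel H) : set (borel R^o) := [set r | A (r *: th)].

Let muE A : mu A = (\int[Pinf]_th rad (sec A th))%E.
Proof.
transitivity (\int[Pinf]_th rad (xsection (sc @^-1` A) th))%E; first by [].
apply: eq_integral => th _; congr (rad _).
by apply/seteqP; split=> r; rewrite /xsection /= inE.
Qed.

Let msc A : measurable A -> measurable (sc @^-1` A).
Proof. by move=> mA; rewrite -[X in measurable X]setTI; exact: sc_measurable. Qed.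

Let msec A th : measurable A -> measurable (sec A th).
Proof.
move=> mA; have := measurable_xsection th (msc mA).
by congr measurable; apply/seteqP; split=> r; rewrite /xsection /= inE.
Qed.

Let msec_fun A : measurable A -> measurable_fun setT (fun th => rad (sec A th)).
Proof.
move=> mA; have := measurable_fun_xsection radsf (msc mA).
congr measurable_fun; apply/funext => th /=; congr (rad _).
by apply/seteqP; split=> r; rewrite /xsection /= inE.
Qed.

(** A positive multiple of a unit vector [th] has angle [th]. Along that ray the positive radii in
    the set are those beyond [r] if [th] is in [A], and none otherwise; [rad] sees positive radii
    only and [Pinf] sees the sphere only. *)
Let mu_polar r A : 0 < r -> measurable A -> A `<=` S ->
  polar mu r A = (nu (outside R^o r) * Pinf A)%E.
Proof.
move=> r0 mA AS; have mS := @unit_sphere_measurable R H.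
rewrite polarE muE; set B := _ `&` _.
have mB : measurable B.
  apply: measurableI; last exact: outside_measurable.
  by rewrite -[X in measurable X]setTI; exact: angle_measurable.
have PnS : Pinf (~` S) = 0%E by rewrite probability_setC// PinfS subee.
have secB th : S th -> rad (sec B th) = (nu (outside R^o r) * (\1_A th)%:E)%E.
  move=> Sth; rewrite indicE radE; have [Ath|Ath] := boolP (th \in A).
    rewrite mule1; congr (nu _); apply/seteqP; rewrite /sec /B /nrm /outside; split=> y /=.
      by move=> [[_]]; rewrite normrZ Sth mulr1 normr_id.
    move=> ry; have y0 : 0 < `|y| by exact: lt_trans ry.
    split; last by move=> y1; move: y0; rewrite y1 ltxx.
    rewrite normrZ Sth mulr1 normr_id; split => //.
    by rewrite angleZ// /angle Sth invr1 scale1r; exact/set_mem.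
  rewrite mule0 -(@measure0 _ _ _ nu); congr (nu _).
  apply/seteqP; split=> // y [[Bth rth]] y0.
  have yp : 0 < nrm y by rewrite lt_neqAle eq_sym normr_ge0 andbT; apply/eqP.
  move/negP : Ath; apply; apply/mem_set; move: Bth.
  by rewrite /preimage/= angleZ// /angle Sth invr1 scale1r.
rewrite (@ge0_negligible_integral _ _ _ Pinf setT (~` S))//; first last.
- exact: msec_fun.
- exact: measurableC.
rewrite setTD setCK.
transitivity (\int[Pinf]_(th in S) (nu (outside R^o r) * (\1_A th)%:E))%E.
  by apply: eq_integral => th; rewrite inE => /secB.
have mi : measurable_fun S (EFin \o (\1_A : borel H -> R)).
  by apply/measurable_EFinP; exact: measurable_indic.
have i0 th : S th -> (0 <= (\1_A th)%:E :> \bar R)%E by rewrite lee_fin.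
rewrite ge0_integralZl//.
by rewrite integral_indic// setIidl.
Qed.

Let mu_outside r : 0 < r -> mu (outside H r) = nu (outside R^o r).
Proof.
move=> r0; have := mu_polar r0 (@unit_sphere_measurable R H) (@subset_refl _ S).
rewrite PinfS mule1 => <-; rewrite polarE angle_sphere setIidr//.
exact/outside_sub/ltW.
Qed.

Lemma radial_measure : exists m : {measure set (borel H) -> \bar R},
  [/\ M0 m, m (@punctured R H) <> 0%E, homogeneous alpha m,
      forall r, 0 < r -> m (outside H r) = nu (outside R^o r) &
      forall r A, 0 < r -> measurable A -> A `<=` S ->
        polar m r A = (nu (outside R^o r) * Pinf A)%E].
Proof.
exists mu; split => //.
(* [bounded_away] is a weak inequality and [outside] a strict one, hence the half radius. *)
- move=> A mA Ap [r r0 Ar]; have r2 : 0 < r / 2 by rewrite divr_gt0.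
  apply: (@le_lt_trans _ _ (mu (outside H (r / 2)))).
    apply: le_measure; rewrite ?inE//; first exact: outside_measurable.
    move=> x /Ar; rewrite /outside/=; apply: lt_le_trans.
    by rewrite ltr_pdivrMr// ltr_pMr// ltr1n.
  by rewrite mu_outside//; exact: M0_outside.
- move=> mu0; have := outside_neq0 M0nu hom_nu nu0; rewrite -mu_outside//.
  suff -> : mu (outside H 1) = 0%E by rewrite ltxx.
  apply/eqP; rewrite eq_le measure_ge0 andbT -mu0; apply: le_measure.
  + by rewrite inE; exact: outside_measurable.
  + by rewrite inE; exact: punctured_measurable.
  + exact: outside_sub.
(* Dilation acts on the radial factor alone, so homogeneity of [nu] is applied section by
   section. *)
- move=> t A t0 mA Ap; rewrite !muE.
  have tp : (0 <= (t `^ (- alpha))%:E)%E by rewrite lee_fin powR_ge0.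
  have mf := msec_fun mA; rewrite -ge0_integralZl//.
  apply: eq_integral => th _.
  have -> : sec (dilate t A) th = dilate t (sec A th).
    rewrite !dilateE ?gt_eqF//; apply/seteqP.
    by split=> r /=; rewrite /sec/= scalerA.
  rewrite !radE -hom_nu//.
  + congr (nu _); rewrite !dilateE ?gt_eqF//; apply/seteqP; rewrite /nrm.
    have nt (y : R^o) : `|t^-1 *: y| = t^-1 * `|y| by rewrite normrZ gtr0_norm// invr_gt0.
    split=> y /=; rewrite nt => -[h1 h2]; split => //.
      move=> /eqP; rewrite mulf_eq0 invr_eq0 gt_eqF//= => /eqP; exact: h2.
    by move=> y0; apply: h2; rewrite y0 mulr0.
  + rewrite (_ : [set _ | _] = nrm @^-1` (sec A th `&` @punctured R R^o)); last by [].
    rewrite -[X in measurable X]setTI; apply: nrm_measurable => //.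
    by apply: measurableI; [exact: msec|exact: punctured_measurable].
  + by move=> y [_ y0] y1; apply: y0; rewrite /nrm y1 normr0.
Qed.

End RadialMeasure.

(** * Angular laws *)

Section AngularLaw.
Context (R : realType) (H : normedModType R).
Local Notation S := (unit_sphere H : set (borel H)).
Context d (Omega : measurableType d) (P : probability Omega R) (X : Omega -> H).
Hypothesis mX : random_element X.

(** The same set function as [angular_law], built so as to carry a measure structure; it is the zero
    measure when the conditioning event is negligible. *)
Definition angular_measure (t : R) : {measure set (borel H) -> \bar R} :=
  mscale (`|(fine (P (exceeds X t)))^-1|%:nng)
    (polar (image_measure P (mX : measurable_fun setT (X : Omega -> borel H))) t).

Lemma angular_measureE t A : angular_measure t A =
  (`|(fine (P (exceeds X t)))^-1|%:E * P ([set w | A (angle (X w))] `&` exceeds X t))%E.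
Proof. by []. Qed.

Lemma angular_lawE t : angular_law P X t = angular_measure t.
Proof.
apply/funext => A; rewrite angular_measureE muleC /angular_law ger0_norm//.
by rewrite invr_ge0 fine_ge0.
Qed.

Lemma angular_measure_setT t : (0 < P (exceeds X t))%E -> angular_measure t setT = 1%E.
Proof.
move=> p0; rewrite -angular_lawE /angular_law (_ : [set _ | _] = setT); last exact/seteqP.
have pf : P (exceeds X t) \is a fin_num.
  by apply: fin_num_measure; exact: exceeds_measurable.
rewrite setTI -[X in (X * _)%E]fineK// -EFinM divff//.
by rewrite fine_eq0// gt_eqF.
Qed.

Lemma angular_measure_sphere t : 0 <= t -> angular_measure t (~` S) = 0%E.
Proof.
move=> t0; rewrite angular_measureE (_ : _ `&` _ = set0) ?measure0 ?mule0//.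
apply/seteqP; split=> // w [/= h1 h2]; apply: h1.
have : (angle @^-1` S) (X w) by rewrite angle_sphere; exact: (outside_sub t0).
exact.
Qed.

(** Scaling by 1/n leaves the angle unchanged and turns |x| > r into |X| > n r. The integral thus
    splits into a tail mass, governed by the norm, and an average under the conditional law at level
    [n r]. *)
Lemma Rintegral_polar_scaled_law b n r (g : H -> R) C : (0 < n)%N -> 0 < r ->
  (0 < P (exceeds X (n%:R * r)))%E -> continuous g -> (forall x, 0 <= g x <= C) ->
  \int[polar (scaled_law P mX b n) r]_(x in S) g x =
  fine (scaled_law P mX b n (outside H r)) *
  \int[angular_measure (n%:R * r)]_(x in S) g x.
Proof.
move=> n0 r0 p0 cg gC; set t := n%:R * r.
have mS := @unit_sphere_measurable R H.
have pf : P (exceeds X t) \is a fin_num.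
  by apply: fin_num_measure; exact: exceeds_measurable.
have p0' : 0 < fine (P (exceeds X t)) by rewrite fine_gt0// p0 ltey_eq pf.
set k := fine _; have k0 : 0 <= k by exact: fine_ge0.
have kE : k = `|b n%:R| * fine (P (exceeds X t)).
  by rewrite /k scaled_law_outside// fineM.
rewrite (@eq_measure_Rintegral _ _ _ _ (mscale (`|k|%:nng) (angular_measure t))).
  rewrite ge0_Rintegral_mscale//.
  - by rewrite /= ger0_norm.
  - apply: measurable_bounded_integrable => //.
    + apply: (@le_lt_trans _ _ (angular_measure t setT)).
        by apply: le_measure; rewrite ?inE.
      by rewrite angular_measure_setT// ltry.
    + by apply: measurable_funTS; exact: borel_continuous_measurable.
    + apply: (@bound_bounded_fun _ _ _ _ C) => x _.
      by have /andP[? ?] := gC x; rewrite ger0_norm.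
  - by move=> x _; have /andP[] := gC x.
move=> A mA _; rewrite polarE scaled_lawE.
rewrite [RHS](_ : _ = `|k|%:E * angular_measure t A)%E// angular_measureE.
have -> : [set w | (angle @^-1` A `&` outside H r) (n%:R^-1 *: X w)] =
    [set w | A (angle (X w))] `&` exceeds X t.
  have ni : 0 < n%:R^-1 :> R by rewrite invr_gt0 ltr0n.
  apply/seteqP; rewrite /exceeds /outside /preimage.
  by split=> w /=; rewrite angleZ// normrZ gtr0_norm// ltr_pdivlMl ?ltr0n.
set q := P _; have qf : q \is a fin_num.
  apply: fin_num_measure; apply: measurableI; last exact: exceeds_measurable.
  rewrite (_ : [set _ | _] = X @^-1` (angle @^-1` A))//.
  rewrite -[Y in measurable Y]setTI; apply: mX => //.
  by rewrite -[Y in measurable Y]setTI; exact: angle_measurable.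
rewrite -(fineK qf) -!EFinM (ger0_norm k0) kE normfV (gtr0_norm p0').
congr EFin; field; exact: lt0r_neq0.
Qed.

End AngularLaw.

(** The normalization [b] of the norm is kept for [X]. On each set |x| > r the tail mass converges
    by regular variation of the norm, and the angular average by hypothesis along the levels [n r],
    which tend to infinity. *)
Lemma regularly_varying_polar (R : realType) (H : normedModType R)
    (sepH : separable H) d (Omega : measurableType d) (P : probability Omega R)
    (X : Omega -> H) (mX : random_element X) (alpha : R)
    (Pinf : probability (borel H) R) :
  0 < alpha -> Pinf (unit_sphere H) = 1%E ->
  regularly_varying P alpha (fun w => `|X w| : R^o) ->
  (forall g : H -> R, continuous g -> [bounded g x | x in unit_sphere H] ->
    \int[angular_measure P mX t]_(x in (unit_sphere H : set (borel H))) g x @[t --> +oo] -->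
    \int[Pinf]_(x in (unit_sphere H : set (borel H))) g x) ->
  regularly_varying P alpha X.
Proof.
set S : set (borel H) := unit_sphere H.
move=> alpha0 PS rvn cvang; have mN := random_element_norm mX.
have excE t : exceeds (fun w => `|X w| : R^o) t = exceeds X t.
  by apply/seteqP; rewrite /exceeds; split=> w /=; rewrite normr_id.
have exc0 t : 0 < t -> (0 < P (exceeds X t))%E.
  by rewrite -excE; exact: (exceeds_gt0 mN rvn).
move: rvn => /(regularly_varyingP P mN)[nu [b [rho [[Mnu nu0] rb b0 cv hom]]]].
have [mu [Mmu mu0 hommu mu_out mu_pol]] := radial_measure sepH PS Mnu nu0 hom.
apply/(regularly_varyingP P mX); exists mu, b, rho; split => //.
have mS := @unit_sphere_measurable R H.
have lawE n r : (0 < n)%N -> 0 < r ->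
    scaled_law P mN b n (outside R^o r) = scaled_law P mX b n (outside H r).
  by move=> n0 r0; rewrite !scaled_law_outside// excE.
apply: polar_M0_Rcvg => //.
- by move=> n; exact: scaled_law_M0.
- move=> g r C r0 cg gC.
  have gC' x : `|g x| <= C by have /andP[? ?] := gC x; rewrite ger0_norm.
  have k0 : 0 <= fine (mu (outside H r)) by exact: fine_ge0.
  have -> : \int[polar mu r]_(x in S) g x =
      fine (mu (outside H r)) * \int[Pinf]_(x in S) g x.
    rewrite (@eq_measure_Rintegral _ _ _ (polar mu r)
      (mscale (`|fine (mu (outside H r))|%:nng) Pinf)).
      rewrite ge0_Rintegral_mscale//.
      - by rewrite [_%:num](ger0_norm k0).
      - have PSf : (Pinf S < +oo)%E by rewrite PS ltry.
        apply: measurable_bounded_integrable => //.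
        + by apply: measurable_funTS; exact: borel_continuous_measurable.
        + by apply: (@bound_bounded_fun _ _ _ _ C) => x _.
      - by move=> x _; have /andP[] := gC x.
    move=> A mA AS; rewrite mu_pol// -mu_out//.
    rewrite [RHS](_ : _ = `|fine (mu (outside H r))|%:E * Pinf A)%E//.
    by rewrite ger0_norm// fineK// ge0_fin_numE//; exact: M0_outside.
  apply: (@cvg_trans _ ((fun n => fine (scaled_law P mN b n (outside R^o r)) *
      \int[angular_measure P mX (n%:R * r)]_(x in S) g x) @ \oo)).
    apply: near_eq_cvg; near=> n; have n0 : (0 < n)%N by near: n; exact: nbhs_infty_gt.
    rewrite lawE// (@Rintegral_polar_scaled_law _ _ _ _ _ _ mX b n r g C)//.
    by apply: exc0; rewrite mulr_gt0// ltr0n.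
  apply: cvgM.
    rewrite mu_out//; apply: (outside_cvg (alpha := alpha)) => // n.
    exact: scaled_law_M0.
  have nr : (n%:R * r)%R @[n --> \oo] --> +oo%R.
    apply/cvgryPge => A; near=> n; rewrite -ler_pdivrMr//.
    by near: n; exact: nbhs_infty_ger.
  have ang : \int[angular_measure P mX t]_(x in S) g x @[t --> +oo] -->
      \int[Pinf]_(x in S) g x.
    by apply: cvang => //; apply: (@bound_bounded_fun _ _ _ _ C) => x _.
  exact: (cvg_comp _ _ nr ang).
- move=> r e e0; pose m := fine (mu (outside H 1)).
  have m0 : 0 <= m by exact: fine_ge0.
  pose A := (m + 1) / e; have A0 : 0 < A by rewrite divr_gt0// ltr_wpDl.
  (* The first term gives M^alpha >= (m + 1)/e, hence a tail m M^(-alpha) below [e]; [r + 1] ensures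
     [r < M] and 1 ensures [0 < M]. *)
  pose M := Num.max (A `^ alpha^-1) (Num.max (r + 1) 1).
  have M0' : 0 < M by rewrite /M !lt_max ltr01 !orbT.
  exists M; first by rewrite /M !lt_max ltrDl ltr01 orbT.
  rewrite (homogeneous_outside Mmu hommu M0') -/m powRN mulrC.
  have AM : A <= M `^ alpha.
    rewrite -[leLHS](powRr1 (ltW A0)) -(mulVf (lt0r_neq0 alpha0)) powRrM.
    apply: (ge0_ler_powR (ltW alpha0)); rewrite ?nnegrE ?powR_ge0 ?(ltW M0')//.
    by rewrite /M le_max lexx.
  rewrite ler_pdivrMr ?powR_gt0//.
  apply: (@le_trans _ _ (e * A)); last by rewrite ler_pM2l.
  by rewrite /A mulrC divfK ?gt_eqF// lerDl.
- apply: contrapT => /set0P/negP/negPn/eqP p0; apply: mu0.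
  by rewrite p0 measure0.
Unshelve. all: by end_near. Qed.

(** * Expectations of functions of sphere-valued random elements *)

Section Laws.
Context (R : realType) (H : normedModType R).
Local Notation S := (unit_sphere H : set (borel H)).

Lemma sphere_integrable (m : {measure set (borel H) -> \bar R}) (f : H -> R) :
  (m setT < +oo)%E -> {within unit_sphere H, continuous f} ->
  [bounded f x | x in unit_sphere H] -> m.-integrable S (EFin \o f).
Proof.
move=> mT cf bf; have mS := @unit_sphere_measurable R H.
apply: measurable_bounded_integrable => //.
  by apply: le_lt_trans mT; apply: le_measure; rewrite ?inE.
exact: borel_within_continuous_measurable.
Qed.

Lemma expectation_law d (Omega : measurableType d) (P : probability Omega R)
    (Y : Omega -> H) (m : {measure set (borel H) -> \bar R}) (f : H -> R) :
  random_element Y -> (forall w, unit_sphere H (Y w)) -> has_law P Y m ->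
  continuous f -> [bounded f x | x in unit_sphere H] ->
  ('E_P[f \o Y] = (\int[m]_(x in S) f x)%:E)%E.
Proof.
move=> mY SY lawY cf bf; have mS := @unit_sphere_measurable R H.
have YS : Y @^-1` S = setT by apply/seteqP; split=> // w _; exact: SY.
have mf : measurable_fun setT (f : borel H -> R) by exact: borel_continuous_measurable.
have PT : (P setT < +oo)%E by rewrite probability_setT ltry.
have ifY : P.-integrable (Y @^-1` S) (EFin \o (f \o Y)).
  rewrite YS; apply: measurable_bounded_integrable => //.
  - exact: (measurableT_comp mf mY).
  - have [C _ fC] := bounded_fun_bound bf.
    by apply: (@bound_bounded_fun _ _ _ _ C) => w _; apply: fC; exact: SY.
have mfS : measurable_fun S (f : borel H -> R) by exact: measurable_funTS.
have E := @integral_image _ _ Omega (borel H) R P Y mY S f mS mfS ifY.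
rewrite unlock; transitivity (\int[P]_(w in Y @^-1` S) (f (Y w))%:E)%E.
  by rewrite YS.
rewrite -E (eq_measure_integral m); last by move=> A mA _; exact: lawY.
rewrite fineK//; apply: integrable_fin_num => //; apply: sphere_integrable => //.
  have mT : measurable (setT : set (borel H)) by exact: measurableT.
  by rewrite -(lawY _ mT) preimage_setT probability_setT ltry.
exact: continuous_subspaceT.
Qed.

End Laws.

Theorem theorem3p1 (R : realType) (H : completeNormedModType R)
  (dot : {dot H for idfun}) (dot_norm : norm_induced_by dot)
  (sepH : separable H)
  (e : nat -> H) (basis_e : orthonormal_basis dot e)
  (d : measure_display) (Omega : measurableType d) (P : probability Omega R)
  (X : Omega -> H) (mX : random_element X)
  (alpha : R) (alpha_gt0 : 0 < alpha)
  (d_ : R -> measure_display) (Omega_ : forall t : R, measurableType (d_ t))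
  (P_ : forall t : R, probability (Omega_ t) R)
  (Theta : forall t : R, Omega_ t -> H)
  (mTheta : forall t : R, 0 < t -> random_element (Theta t))
  (sphere_Theta : forall t : R, 0 < t -> forall w, unit_sphere H (Theta t w))
  (law_Theta : forall t : R, 0 < t -> (0 < P (exceeds X t))%E ->
     has_law (P_ t) (Theta t) (angular_law P X t))
  (Pinf : probability (borel H) R) (sphere_Pinf : Pinf (unit_sphere H) = 1%E)
  (dinf : measure_display) (Omega_inf : measurableType dinf)
  (P_inf : probability Omega_inf R)
  (Theta_inf : Omega_inf -> H) (mTheta_inf : random_element Theta_inf)
  (sphere_Theta_inf : forall w, unit_sphere H (Theta_inf w))
  (law_Theta_inf : has_law P_inf Theta_inf Pinf) :
  [<-> regularly_varying P alpha X /\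
       weak_cvg_on (unit_sphere H) (angular_law P X) Pinf;
       regularly_varying P alpha (fun w => `|X w| : R^o) /\
       (forall h : H,
          cvg_in_distribution P_ (fun t w => dot (Theta t w) h)
                              P_inf (fun w => dot (Theta_inf w) h));
       regularly_varying P alpha (fun w => `|X w| : R^o) /\
       (forall N : nat, (1 <= N)%N ->
          cvg_in_distribution P_ (fun t w => coordinates dot e N (Theta t w))
                              P_inf (fun w => coordinates dot e N (Theta_inf w)))].

Proof.
have mS := @unit_sphere_measurable R H.
set S : set (borel H) := unit_sphere H in mS *.
pose ang t := angular_measure P mX t.
have Pinf_fin : (Pinf setT < +oo)%E by rewrite probability_setT ltry.
have ang_fin : (forall t, 0 < t -> (0 < P (exceeds X t))%E) ->
    \forall t \near +oo, (ang t setT < +oo)%E /\ ang t (~` S) = 0%E.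
  move=> exc0; near=> t; have t0 : 0 < t by near: t; exact: nbhs_pinfty_gt.
  by rewrite /ang angular_measure_setT ?exc0// ltry angular_measure_sphere// ltW.
(* Stated for an arbitrary continuous map [c], so as to serve inner products and coordinates alike.
   The law of [Theta t] is prescribed for positive [t] only, whence equalities near infinity. *)
have distE (T : topologicalType) (c : H -> T) : continuous c ->
    (forall t, 0 < t -> (0 < P (exceeds X t))%E) ->
    cvg_in_distribution P_ (fun t w => c (Theta t w)) P_inf (fun w => c (Theta_inf w)) <->
    forall g : T -> R, continuous g -> [bounded g y | y in [set: T]] ->
      \int[ang t]_(x in S) g (c x) @[t --> +oo] --> \int[Pinf]_(x in S) g (c x).
  move=> cc exc0.
  have cgc (g : T -> R) : continuous g -> continuous (g \o c).
    by move=> cg x; apply: continuous_comp; [exact: cc|exact: cg].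
  have bgc (g : T -> R) : [bounded g y | y in [set: T]] ->
      [bounded (g \o c) x | x in unit_sphere H].
    move=> /bounded_fun_bound[C _ gC]; apply: (@bound_bounded_fun _ _ _ _ C).
    by move=> x _; exact: gC.
  have Et (g : T -> R) : continuous g -> [bounded g y | y in [set: T]] ->
      \forall t \near +oo, ('E_(P_ t)[g \o (fun w => c (Theta t w))] =
        (\int[ang t]_(x in S) g (c x))%:E)%E.
    move=> cg bg; near=> t; have t0 : 0 < t by near: t; exact: nbhs_pinfty_gt.
    apply: (expectation_law (f := g \o c));
      [exact: mTheta|exact: sphere_Theta| |exact: cgc|exact: bgc].
    by move=> A mA; rewrite law_Theta// ?exc0// (angular_lawE P mX).
  have Einf (g : T -> R) : continuous g -> [bounded g y | y in [set: T]] ->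
      ('E_P_inf[g \o (fun w => c (Theta_inf w))] = (\int[Pinf]_(x in S) g (c x))%:E)%E.
    move=> cg bg; apply: (expectation_law (f := g \o c)) => //.
    - exact: cgc.
    - exact: bgc.
  split=> h g cg bg.
    have := h g cg bg; rewrite Einf// => hg.
    have : (\int[ang t]_(x in S) g (c x))%:E @[t --> +oo] --> (\int[Pinf]_(x in S) g (c x))%:E.
      apply: cvg_trans hg; apply: near_eq_cvg; apply: filterS (Et g cg bg) => t ->.
      by [].
    by move/fine_cvg; exact.
  rewrite Einf//.
  have : (\int[ang t]_(x in S) g (c x))%:E @[t --> +oo] --> (\int[Pinf]_(x in S) g (c x))%:E.
    by apply: cvg_EFin; [near=> t|exact: h].
  by apply: cvg_trans; apply: near_eq_cvg; apply: filterS (Et g cg bg) => t ->.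
have weakE : (forall t, 0 < t -> (0 < P (exceeds X t))%E) ->
    weak_cvg_on (unit_sphere H) (angular_law P X) Pinf <->
    forall f : H -> R, {within unit_sphere H, continuous f} ->
      [bounded f x | x in unit_sphere H] ->
      \int[ang t]_(x in S) f x @[t --> +oo] --> \int[Pinf]_(x in S) f x.
  move=> exc0.
  have Et (f : H -> R) : {within unit_sphere H, continuous f} ->
      [bounded f x | x in unit_sphere H] -> \forall t \near +oo,
      (\int[angular_law P X t]_(x in S) (f x)%:E = (\int[ang t]_(x in S) f x)%:E)%E.
    move=> cf bf; near=> t; have t0 : 0 < t by near: t; exact: nbhs_pinfty_gt.
    rewrite (angular_lawE P mX) fineK//; apply: integrable_fin_num => //.
    by apply: sphere_integrable => //; rewrite angular_measure_setT ?ltry ?exc0.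
  have Einf (f : H -> R) : {within unit_sphere H, continuous f} ->
      [bounded f x | x in unit_sphere H] ->
      (\int[Pinf]_(x in S) (f x)%:E = (\int[Pinf]_(x in S) f x)%:E)%E.
    move=> cf bf; rewrite fineK//; apply: integrable_fin_num => //.
    exact: sphere_integrable.
  split=> h f cf bf.
    have := h f cf bf; rewrite Einf// => hf.
    have : (\int[ang t]_(x in S) f x)%:E @[t --> +oo] --> (\int[Pinf]_(x in S) f x)%:E.
      apply: cvg_trans hf; apply: near_eq_cvg; apply: filterS (Et f cf bf) => t ->.
      by [].
    by move/fine_cvg; exact.
  rewrite Einf//.
  have : (\int[ang t]_(x in S) f x)%:E @[t --> +oo] --> (\int[Pinf]_(x in S) f x)%:E.
    by apply: cvg_EFin; [near=> t|exact: h].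
  by apply: cvg_trans; apply: near_eq_cvg; apply: filterS (Et f cf bf) => t ->.
(* The second and third statements only give regular variation of the norm, whose own exceedance
   events are those of [X]. *)
have exc_norm : regularly_varying P alpha (fun w => `|X w| : R^o) ->
    forall t, 0 < t -> (0 < P (exceeds X t))%E.
  move=> rv t t0; have := exceeds_gt0 (random_element_norm mX) rv t0.
  congr (_ < P _)%E; apply/seteqP; rewrite /exceeds.
  by split=> w /=; rewrite normr_id.
have PnS : Pinf (~` S) = 0%E by rewrite probability_setC// sphere_Pinf subee.
(* A value of [Theta_inf] witnesses that the space is not reduced to 0. *)
have S0 : S !=set0 by exists (Theta_inf point); exact: sphere_Theta_inf.
have dot_cont h : continuous (dot ^~ h) by exact: dot_continuous.
have crd_cont N : continuous (coordinates dot e N) by exact: coordinates_continuous.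
tfae.
- move=> [rvX wX]; have exc0 t := exceeds_gt0 (t := t) mX rvX.
  split; first exact: regularly_varying_norm.
  move=> h; apply/(distE _ _ (dot_cont h) exc0) => g cg /bounded_fun_bound[C _ gC].
  apply: ((weakE exc0).1 wX (fun x => g (dot x h))).
    apply: continuous_subspaceT => x; apply: (@continuous_comp H R R (dot ^~ h) g).
      exact: dot_cont.
    exact: cg.
  by apply: (@bound_bounded_fun _ _ _ _ C) => x _; exact: gC.
- move=> [rvn ridge]; split => // N N1; have exc0 := exc_norm rvn.
  apply/(distE _ _ (crd_cont N) exc0) => g cg bg.
  apply: (ridge_coordinates_cvg dot_norm basis_e) => //; first exact: ang_fin.
  by move=> h; exact/(distE _ _ (dot_cont h) exc0).
- move=> [rvn fidi]; have exc0 := exc_norm rvn.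
  (* Used twice: it is the angular half of the first statement, and it feeds the construction that
     gives regular variation of [X]. *)
  have weak : forall f : H -> R, {within unit_sphere H, continuous f} ->
      [bounded f x | x in unit_sphere H] ->
      \int[ang t]_(x in S) f x @[t --> +oo] --> \int[Pinf]_(x in S) f x.
    apply: (coordinates_weak_cvg dot_norm basis_e) => //; first exact: ang_fin.
    by move=> N g N1; exact: ((distE _ _ (crd_cont N) exc0).1 (fidi N N1)).
  split; last exact/(weakE exc0).
  apply: (regularly_varying_polar sepH alpha_gt0 sphere_Pinf rvn) => g cg bg.
  by apply: weak => //; exact: continuous_subspaceT.
Unshelve. all: by end_near. Qed.
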